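(* Let $X_B$ be the Bestvina realization of a regular building of type $(W,S)$ and thickness vector $\mathbf{q}+1$, with $\mathbf{q}\geq2$. Let $d=\dim X_B=\mathrm{vcd}_{\mathbb{R}}(W)$. For all $p>1+e_{\mathbf{q}}(W)$, we have $\ell^pH_d(X_B)\neq\{0\}$.
   Context: Throughout, $(W,S)$ is a Coxeter system with $S$ finite and $W$ infinite; $W_T=\langle T\rangle$ for $T\subseteq S$. Buildings. A chamber system over $S$ is a set $\mathcal{C}$ (of chambers) with an equivalence relation ($s$-equivalence) for each $s\in S$; distinct $s$-equivalent chambers are $s$-adjacent. A gallery of type $(s_1,\dots,s_k)$ is a sequence $c_0,\dots,c_k$ with $c_{i-1}$ $s_i$-adjacent to $c_i$. A building of type $(W,S)$ is a chamber system $\mathcal{C}$ over $S$ whose $s$-equivalence classes all have at least two elements, with a map $d_W:\mathcal{C}\times\mathcal{C}\to W$ such that for every reduced word $s_1\cdots s_k$, two chambers $c,c'$ are joined by a gallery of type $(s_1,\dots,s_k)$ iff $d_W(c,c')=s_1\cdots s_k$. It is regular with (finite) thickness vector $\mathbf{q}+1$, $\mathbf{q}=(q_s)_{s\in S}$, if every $s$-equivalence class has exactly $q_s+1<\infty$ elements; $\mathbf{q}\ge2$ means all $q_s\ge2$. For $w\in W$ with reduced expression $s_1\cdots s_k$ put $q_w=q_{s_1}\cdots q_{s_k}$ (well defined), and $e_{\mathbf{q}}(W)=\limsup_n\frac1n\log|\{w\in W:q_w\le e^n\}|$. Bestvina realization. Let $\mathcal{F}$ be the poset of subsets $F\subseteq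 S$ (including $\emptyset$) with $W_F$ finite. For $F$ maximal in $\mathcal{F}$ let $P_F$ be a point. If $P_{F'}$ has been constructed for all $F'\in\mathcal{F}$ with $F'\supsetneq F$, let $P_F$ be a finite $\mathbb{R}$-acyclic simplicial complex containing $\bigcup_{F'\supsetneq F}P_{F'}$ and of least possible dimension; the added simplices for different $F$ are disjoint, so $P_F\cap P_{F'}=P_{F\cup F'}$ if $F\cup F'\in\mathcal{F}$ and is empty otherwise. ($\mathbb{R}$-acyclic: same real homology as a point.) The Bestvina chamber is $B=P_\emptyset$, with mirrors $B_s=P_{\{s\}}$, $s\in S$. For $x\in B$ let $S(x)=\{s:x\in B_s\}$. The Bestvina realization of $\mathcal{C}$ is $X_B=(\mathcal{C}\times B)/\sim$ where $(c,x)\sim(c',x')$ iff $x=x'$ and $d_W(c,c')\in W_{S(x)}$. $\mathrm{vcd}_{\mathbb{R}}(W)$ is the virtual cohomological dimension of $W$ over $\mathbb{R}$: the cohomological dimension over $\mathbb{R}$ of any torsion-free finite index subgroup. $\ell^p$-homology. For a locally finite simplicial complex $X$ of bounded geometry (oriented simplices, $X^{(k)}$ the $k$-simplices), $\ell^pC_k(X)$ is the space of formal sums $\sum_{\sigma\in X^{(k)}}a_\sigma\sigma$ with $(a_\sigma)\in\ell^p(X^{(k)})$, with the usual bounded boundary $\partial_k$, and $\ell^pH_k(X)=\ker\partial_k/\operatorname{Im}\partial_{k+1}$. *)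

(* Defs.v *)
From HB Require Import structures.
From mathcomp Require Import all_boot all_order all_algebra.
From mathcomp Require Import all_classical all_reals all_analysis.

Set Implicit Arguments.
Unset Strict Implicit.
Unset Printing Implicit Defensive.

Import Order.TTheory GRing.Theory Num.Theory.

Local Open Scope classical_set_scope.
Local Open Scope ring_scope.

Definition wprod (W : groupType) (S : Type) (gen : S -> W) (u : seq S) : W :=
  (\prod_(s <- u) gen s)%g.

(* A Coxeter matrix; the value 0 encodes the entry infinity. *)
Definition coxeter_matrix (S : eqType) (m : S -> S -> nat) : Prop :=
  [/\ forall s, m s s = 1%N,
      forall s t, m s t = m t s &
      forall s t, s != t -> m s t != 1%N].

(* The congruence on words generated by (st)^m(s,t) ~ 1.  Since m(s,s) = 1
   makes every letter its own inverse, the quotient monoid of words is the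
   group < S | (st)^m(s,t) >.  When m(s,t) = 0 the relation is void. *)
Inductive cox_equiv (S : Type) (m : S -> S -> nat) : seq S -> seq S -> Prop :=
| cox_rel u v s t :
    cox_equiv m (u ++ flatten (nseq (m s t) [:: s; t]) ++ v) (u ++ v)
| cox_refl u : cox_equiv m u u
| cox_sym u v : cox_equiv m u v -> cox_equiv m v u
| cox_trans u v w : cox_equiv m u v -> cox_equiv m v w -> cox_equiv m u w.

Definition coxeter_system (W : groupType) (S : finType) (gen : S -> W) : Prop :=
  exists m : S -> S -> nat,
    [/\ coxeter_matrix m,
        forall w, exists u, wprod gen u = w &
        forall u v, wprod gen u = wprod gen v <-> cox_equiv m u v].

Definition reduced (W : groupType) (S : Type) (gen : S -> W) (u : seq S) :
    Prop :=
  forall v, wprod gen v = wprod gen u -> (size u <= size v)%N.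

(* W_T; as generators are involutions, words in T suffice. *)
Definition parabolic (W : groupType) (S : finType) (gen : S -> W)
    (T : {set S}) : set W :=
  [set w | exists2 u : seq S, {subset u <= T} & wprod gen u = w].

Definition spherical (W : groupType) (S : finType) (gen : S -> W)
    (T : {set S}) : Prop :=
  finite_set (parabolic gen T).

(* q_w, computed on a chosen reduced word; when q is the thickness of a regular
   building of type (W,S) the value does not depend on that choice. *)
Definition q_weight (W : groupType) (S : finType) (gen : S -> W)
    (q : S -> nat) (w : W) : nat :=
  (\prod_(s <- xget [::] [set u | reduced gen u /\ wprod gen u = w]) q s)%N.

(* Junk value 0 on infinite sets; below it is only relevant for finite ones. *)
Definition cardinal (T : Type) (A : set T) : nat :=
  xget 0%N [set k | (A #= `I_k)%card].

(* e_q(W).  All balls are finite as soon as q >= 2. *)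
Definition growth (R : realType) (W : groupType) (S : finType) (gen : S -> W)
    (q : S -> nat) : \bar R :=
  limn_esup (fun n : nat =>
    (n%:R^-1 *
     ln (cardinal [set w : W | (q_weight gen q w)%:R <= expR (n%:R : R)])%:R
    )%:E).

Record chamber_system (S : Type) := ChamberSystem {
  chamber :> Type;
  sequiv : S -> chamber -> chamber -> Prop;
  sequivP : forall s, RelationClasses.Equivalence (sequiv s)
}.

Definition sadj (S : Type) (C : chamber_system S) (s : S) (c c' : C) : Prop :=
  sequiv s c c' /\ c <> c'.

Fixpoint gallery (S : Type) (C : chamber_system S) (u : seq S) (c c' : C) :
    Prop :=
  if u is s :: u' then exists2 c1 : C, sadj s c c1 & gallery u' c1 c'
  else c = c'.

(* The empty chamber system is excluded. *)
Record building (W : groupType) (S : finType) (gen : S -> W) := Building {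
  chambers :> chamber_system S;
  dW : chambers -> chambers -> W;
  building_inhabited : inhabited chambers;
  building_thick : forall s (c : chambers), exists c', sadj s c c';
  building_gallery : forall (u : seq S) (c c' : chambers),
    reduced gen u -> (gallery u c c' <-> dW c c' = wprod gen u)
}.

Definition regular_building (W : groupType) (S : finType) (gen : S -> W)
    (C : building gen) (q : S -> nat) : Prop :=
  forall s (c : C), ([set c' : C | sequiv s c c'] #= `I_(q s).+1)%card.

Definition residue (W : groupType) (S : finType) (gen : S -> W)
    (C : building gen) (T : {set S}) (c : C) : set C :=
  [set c' | parabolic gen T (dW c c')].

(* [cells] carves the cells out of an ambient type; [inc x y] is the
   coefficient of y in the boundary of x, for a fixed orientation of cells. *)
Record cell_complex (R : realType) := CellComplex {
  ambient : choiceType;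
  cells : set ambient;
  cdim : ambient -> nat;
  inc : ambient -> ambient -> R
}.

Arguments cells {R} X x : rename.

Definition has_dim (R : realType) (X : cell_complex R) (d : nat) : Prop :=
  (exists2 x, cells X x & cdim x = d) /\
  (forall x, cells X x -> (cdim x <= d)%N).

Definition chain (R : realType) (X : cell_complex R) (k : nat)
    (a : ambient X -> R) : Prop :=
  forall x, a x != 0 -> cells X x /\ cdim x = k.

(* The sum has finite support whenever each cell lies in the boundary of only
   finitely many cells. *)
Definition boundary (R : realType) (X : cell_complex R)
    (a : ambient X -> R) : ambient X -> R :=
  (fun y => \sum_(x \in cells X) (inc x y * a x)) \_ (cells X).

Definition is_boundary (R : realType) (X : cell_complex R) (k : nat)
    (a : ambient X -> R) : Prop :=
  exists2 b, chain k.+1 b & boundary b = a.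

Definition lp_chain (R : realType) (X : cell_complex R) (p : R) (k : nat)
    (a : ambient X -> R) : Prop :=
  chain k a /\ (\esum_(x in cells X) (`|a x| `^ p)%:E < +oo)%E.

(* l^p H_k(X) <> 0, for the unreduced quotient ker / im. *)
Definition lp_homology_nonzero (R : realType) (X : cell_complex R) (p : R)
    (k : nat) : Prop :=
  exists a : ambient X -> R,
    [/\ lp_chain p k a, boundary a = (fun _ => 0) &
        ~ exists2 b, lp_chain p k.+1 b & boundary b = a].

Definition simplicial_complex (n : nat) (K : {set {set 'I_n}}) : Prop :=
  forall x, x \in K ->
    x != finset.set0 /\
    (forall y : {set 'I_n}, y \subset x -> y != finset.set0 -> y \in K).

(* Simplices are oriented by increasing order of vertices. *)
Definition simplex_inc (R : realType) (n : nat) (x y : {set 'I_n}) : R :=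
  \sum_(v in x | y == (x :\ v)%SET) (-1) ^+ #|[pred u in x | (u < v)%N]|.

Definition simplicial_cells (R : realType) (n : nat) (K : {set {set 'I_n}}) :
    cell_complex R :=
  @CellComplex R {set 'I_n} [set x | x \in K] (fun x => #|x|.-1)
    (@simplex_inc R n).

(* Same real homology as a point: H_0 is a line and H_k = 0 for k > 0. *)
Definition acyclic (R : realType) (n : nat) (K : {set {set 'I_n}}) : Prop :=
  let X := simplicial_cells R K in
  (exists a : ambient X -> R,
     [/\ chain 0 a, ~ is_boundary 0 a &
         forall b : ambient X -> R, chain 0 b ->
           exists c : R, is_boundary 0 (fun x => b x - c * a x)]) /\
  (forall k (a : ambient X -> R), (0 < k)%N ->
     chain k a -> boundary a = (fun _ => 0) -> is_boundary k a).

Definition simplicial_dim (n : nat) (K : {set {set 'I_n}}) : nat :=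
  (\max_(x in K) #|x|.-1)%N.

Definition union_above (W : groupType) (S : finType) (gen : S -> W) (n : nat)
    (P : {set S} -> {set {set 'I_n}}) (F : {set S}) : set {set 'I_n} :=
  [set x | exists F' : {set S}, [/\ spherical gen F', F \proper F' & x \in P F']].

(* f maps the subcomplex L isomorphically onto a subcomplex of K. *)
Definition simplicial_embedding (n m : nat) (L : set {set 'I_n})
    (K : {set {set 'I_m}}) (f : 'I_n -> 'I_m) : Prop :=
  (forall x y u v, L x -> L y -> u \in x -> v \in y -> f u = f v -> u = v) /\
  (forall x, L x -> (f @: x)%SET \in K).

(* Only the values of P on spherical subsets are constrained.  All the P F are
   subcomplexes of P set0, on a common set of vertices. *)
Record bestvina_chamber (R : realType) (W : groupType) (S : finType)
    (gen : S -> W) (n : nat) (P : {set S} -> {set {set 'I_n}}) : Prop :=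
  BestvinaChamber {
  bestvina_complex : forall F, spherical gen F -> simplicial_complex (P F);
  bestvina_max : forall F, spherical gen F ->
    (forall F' : {set S}, F \proper F' -> ~ spherical gen F') ->
    exists v : 'I_n, P F = [set [set v]]%SET;
  bestvina_sub : forall F, spherical gen F ->
    union_above gen P F `<=` [set x | x \in P F];
  bestvina_acyclic : forall F, spherical gen F -> acyclic R (P F);
  bestvina_least : forall F, spherical gen F ->
    forall (m : nat) (K : {set {set 'I_m}}) (f : 'I_n -> 'I_m),
      simplicial_complex K -> acyclic R K ->
      simplicial_embedding (union_above gen P F) K f ->
      (simplicial_dim (P F) <= simplicial_dim K)%N;
  bestvina_disjoint : forall F F' x, spherical gen F -> spherical gen F' ->
    x \in P F -> ~ union_above gen P F x ->
    x \in P F' -> ~ union_above gen P F' x -> F = F'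
}.

(* S(x) for x in the open simplex; the mirror B_s is P {s}. *)
Definition simplex_type (S : finType) (n : nat)
    (P : {set S} -> {set {set 'I_n}}) (x : {set 'I_n}) : {set S} :=
  [set s | x \in P [set s]%SET]%SET.

(* In (C * B)/~ the open simplices are the classes of C * {x}, x a simplex of
   B: pairs (r, x) with r a residue of type S(x).  They are recorded as such
   pairs, not by their vertices, since distinct simplices could share all their
   vertices when a mirror is not a full subcomplex of B.  They are oriented as
   x; the face of (r, x) along a face y of x is (r', y), where r' is the residue
   of type S(y) containing r. *)
Definition bestvina_realization (R : realType) (W : groupType) (S : finType)
    (gen : S -> W) (C : building gen) (n : nat)
    (P : {set S} -> {set {set 'I_n}}) : cell_complex R :=
  @CellComplex R (set C * {set 'I_n})%type
    [set z | z.2 \in P finset.set0 /\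
             exists c : C, z.1 = residue (simplex_type P z.2) c]
    (fun z => #|z.2|.-1)
    (fun z z' => if `[< z.1 `<=` z'.1 >] then simplex_inc R z.2 z'.2 else 0).

(* A module over the group ring R[G], as an R-module with a linear action. *)
Record group_module (R : realType) (G : groupType) := GroupModule {
  gmod :> lmodType R;
  gact : G -> gmod -> gmod;
  gact1 : forall x, gact 1%g x = x;
  gactM : forall g h x, gact (g * h)%g x = gact g (gact h x);
  gact_linear : forall g a x y,
    gact g (a *: x + y) = a *: gact g x + gact g y
}.

(* Homogeneous cochains: H^*(G; M) is computed by Hom_G(-, M) on the
   resolution of R by the R[G]-modules R[G^(k+1)].  Nothing bounds in degree 0. *)
Definition cochain (R : realType) (G : groupType) (M : group_module R G)
    (k : nat) (f : ('I_k.+1 -> G) -> M) : Prop :=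
  forall g x, f (fun i => g * x i)%g = gact g (f x).

Definition coboundary (R : realType) (G : groupType) (M : group_module R G)
    (k : nat) (f : ('I_k.+1 -> G) -> M) : ('I_k.+2 -> G) -> M :=
  fun x => \sum_(i < k.+2) (-1) ^+ i *: f (fun j => x (lift i j)).

Definition cohomology_zero (R : realType) (G : groupType)
    (M : group_module R G) (k : nat) : Prop :=
  forall f : ('I_k.+1 -> G) -> M,
    cochain f -> coboundary f = (fun _ => 0) ->
    match k return (('I_k.+1 -> G) -> M) -> Prop with
    | 0 => fun f => f = (fun _ => 0)
    | k'.+1 => fun f => exists2 h : ('I_k'.+1 -> G) -> M,
                 cochain h & coboundary h = f
    end f.

(* d is the largest degree in which G has nonzero cohomology, which is the
   projective dimension of the trivial module R over R[G]. *)
Definition cohomological_dim (R : realType) (G : groupType) (d : nat) : Prop :=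
  (forall k (M : group_module R G), (d < k)%N -> cohomology_zero M k) /\
  (exists M : group_module R G, ~ cohomology_zero M d).

(* i identifies G with a torsion-free subgroup of finite index in W. *)
Definition torsion_free_finite_index (G W : groupType) (i : G -> W) : Prop :=
  [/\ forall g h, i (g * h)%g = (i g * i h)%g, injective i,
      forall (g : G) k, (0 < k)%N -> (g ^+ k)%g = 1%g -> g = 1%g &
      exists n (v : 'I_n -> W), forall w, exists j g, w = (v j * i g)%g].

Definition virtual_cohomological_dim (R : realType) (W : groupType) (d : nat) :
    Prop :=
  (exists (G : groupType) (i : G -> W), torsion_free_finite_index i) /\
  (forall (G : groupType) (i : G -> W), torsion_free_finite_index i ->
     cohomological_dim R G d).

(* Main.v *)
(* In the top dimension d a nonzero l^p cycle suffices.  Take F maximal among the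
   spherical sets with dim P_F = d.  The minimality of dim P_F forces a nonzero
   d-chain z of P_F whose boundary lies in the union of the P_G with G strictly
   containing F: otherwise d-simplices of P_F could be removed together with
   (d-1)-faces outside that union, leaving an acyclic complex of smaller
   dimension.  Fix a chamber c0, and spread z over the residue of type S - F of
   c0 with weight (-1)^l(w) / q_w on the copy at distance w.  In a panel one
   chamber is at some distance w and the q_s others are at distance ws > w, so
   the weights cancel over panels of type s in S - F, hence over the copies of
   each boundary simplex.  As q_w chambers lie at distance w, the p-norm is at
   most a multiple of the sum of q_w^(1-p) over W, finite for p - 1 > e_q(W). *)
Require Import Defs.
From mathcomp Require Import finmap ring lra.
From mathcomp Require Import all_boot all_order all_algebra.
From mathcomp Require Import all_classical all_reals all_analysis.

Import Order.TTheory GRing.Theory Num.Theory.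

Local Open Scope classical_set_scope.
Local Open Scope ring_scope.

Set Implicit Arguments.
Unset Strict Implicit.
Unset Printing Implicit Defensive.

(** * Words and reflections in Coxeter groups *)

(** The simplices of [z] have type exactly [F], so their copies are indexed by residues of type [F]
    and not by chambers. A weight on chambers spreads over them without overlap because a residue of
    type S - F meets a residue of type [F] at most once. This rests on W_F and W_(S-F) meeting
    trivially, hence on no generator being a product of other generators. A presentation does not
    show this; Tits' geometric representation does.

    A simplex [y] in the union of the larger P_G has a type S(y) strictly containing [F]. A letter
    of S(y) - F makes the set of weighted chambers around [y] closed under panels of that letter,
    and S(y) being spherical makes this set finite, so the cancellation applies to each [y]
    separately.

    Maximality of [F] keeps d-simplices out of that union, so all of them can be deleted without
    touching it. The (d-1)-simplices to delete with them come from linear algebra: they are rows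
    cutting an invertible square block out of the boundary matrix. *)

Section Words.

Variables (W : groupType) (S : finType) (gen : S -> W).
Hypothesis hcox : coxeter_system gen.

Local Notation wp := (wprod gen).

Lemma wprod_nil : wp [::] = 1%g.
Proof. by rewrite /wprod big_nil. Qed.

Lemma wprod_cons s u : wp (s :: u) = (gen s * wp u)%g.
Proof. by rewrite /wprod big_cons. Qed.

Lemma wprod_cat u v : wp (u ++ v) = (wp u * wp v)%g.
Proof. by rewrite /wprod big_cat. Qed.

Lemma wprod_rcons u s : wp (rcons u s) = (wp u * gen s)%g.
Proof. by rewrite -cats1 wprod_cat wprod_cons wprod_nil mulg1. Qed.

Lemma wprod_surj w : exists u, wp u = w.
Proof. by case: hcox => m []. Qed.

Lemma wprod_gen s : wp [:: s] = gen s.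
Proof. by rewrite wprod_cons wprod_nil mulg1. Qed.

Lemma gen_sq s : (gen s * gen s)%g = 1%g.
Proof.
have [m [[mss _ _] _ mrel]] := hcox.
have : cox_equiv m [:: s; s] [::].
  by have := cox_rel m [::] [::] s s; rewrite mss.
by move/mrel; rewrite wprod_nil !wprod_cons wprod_nil mulg1.
Qed.

Lemma genV s : (gen s)^-1%g = gen s.
Proof. by apply: (mulgI (gen s)); rewrite mulgV gen_sq. Qed.

Lemma mulgss w s : (w * gen s * gen s)%g = w.
Proof. by rewrite -mulgA gen_sq mulg1. Qed.

Lemma wprod_rev u : wp (rev u) = (wp u)^-1%g.
Proof.
elim: u => [|s u IH]; first by rewrite wprod_nil invg1.
by rewrite rev_cons wprod_rcons IH wprod_cons invgM genV.
Qed.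

(** Every relator has even length, so the parity of the length is an invariant of the group
    element. *)
Lemma cox_equiv_odd m u v : @cox_equiv S m u v -> odd (size u) = odd (size v).
Proof.
elim => {u v} [u v s t|//|u v _ ->//|u v w _ -> _ ->//].
have even k : odd (size (flatten (nseq k [:: s; t]))) = false.
  by elim: k => //= k IH; rewrite negbK.
by rewrite !size_cat !oddD even addFb.
Qed.

Lemma wprod_odd u v : wp u = wp v -> odd (size u) = odd (size v).
Proof. by case: hcox => m [_ _ mrel] /mrel /cox_equiv_odd. Qed.

(** For u = s_1 ... s_k these are the elements s_1 ... s_i ... s_1, the walls crossed by the gallery
    of [u] in the Coxeter complex. *)
Fixpoint reflections (u : seq S) : seq W :=
  if u is s :: u' then
    gen s :: [seq (gen s * t * gen s)%g | t <- reflections u']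
  else [::].

Lemma size_reflections u : size (reflections u) = size u.
Proof. by elim: u => //= s u IH; rewrite size_map IH. Qed.

Lemma reflections_cat u v : reflections (u ++ v) =
  reflections u ++ [seq (wp u * t * (wp u)^-1)%g | t <- reflections v].
Proof.
elim: u => [|s u IH] /=.
  by rewrite wprod_nil invg1; elim: (reflections v) => //= t l <-;
    rewrite mul1g mulg1.
rewrite IH map_cat -map_comp; congr (_ :: _ ++ _); apply: eq_map => t /=.
by rewrite wprod_cons invgM genV !mulgA.
Qed.

Lemma count_map_conj (w t : W) l :
  count_mem t [seq (w * x * w^-1)%g | x <- l] = count_mem (w^-1 * t * w)%g l.
Proof.
rewrite count_map; apply: eq_count => x /=.
apply/eqP/eqP => [<-|->]; first by rewrite !mulgA mulVg mul1g mulgVK.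
by rewrite !mulgA mulgV mul1g mulgK.
Qed.

Lemma wprod_flatten_nseq k s t :
  wp (flatten (nseq k [:: s; t])) = ((gen s * gen t) ^+ k)%g.
Proof.
elim: k => [|k IH]; first by rewrite wprod_nil expg0.
by rewrite /= !wprod_cons IH mulgA expgS.
Qed.

Fixpoint alternating (s t : S) (n : nat) : seq S :=
  if n is n'.+1 then s :: alternating t s n' else [::].

Lemma flatten_nseqE m s t :
  flatten (nseq m [:: s; t]) = alternating s t m.*2.
Proof. by elim: m => //= m ->. Qed.

Lemma mul_expg_swap (x y : W) k : (x * ((y * x) ^+ k * y) = (x * y) ^+ k.+1)%g.
Proof.
elim: k => [|k IH]; first by rewrite expg0 mul1g expg1.
by rewrite expgS [RHS]expgS -IH !mulgA.
Qed.

Lemma reflections_alternating n s t : reflections (alternating s t n) =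
  [seq ((gen s * gen t) ^+ k * gen s)%g | k <- iota 0 n].
Proof.
elim: n s t => // n IH s t /=; rewrite expg0 mul1g; congr (_ :: _).
rewrite IH -map_comp -(addn0 1%N) iotaDl -map_comp.
by apply: eq_map => k /=; rewrite mul_expg_swap.
Qed.

(* Since (st)^m = 1, the reflections of the word (st)^m form a sequence of
   period m and length 2m. *)
Lemma reflections_relation m s t x : ((gen s * gen t) ^+ m)%g = 1%g ->
  odd (count_mem x (reflections (flatten (nseq m [:: s; t])))) = false.
Proof.
move=> rm; rewrite flatten_nseqE reflections_alternating -addnn iotaD map_cat.
have -> : iota (0 + m) m = [seq (m + k)%N | k <- iota 0 m].
  by rewrite -iotaDl addnC.
rewrite count_cat -map_comp.
rewrite [X in (_ + count_mem _ X)%N](_ : _ =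
  [seq ((gen s * gen t) ^+ k * gen s)%g | k <- iota 0 m]).
  by rewrite addnn odd_double.
by apply: eq_map => k /=; rewrite expgnDr rm mul1g.
Qed.

(** The set of walls crossed an odd number of times depends on the group element only: a relator
    inserted after [u] contributes its own reflections, conjugated, an even number of times each,
    and being trivial it does not change the conjugation of the later ones. *)
Lemma wprod_reflections_odd u v x : wp u = wp v ->
  odd (count_mem x (reflections u)) = odd (count_mem x (reflections v)).
Proof.
have [m [_ _ mrel]] := hcox; move/mrel => uv; elim: uv x => {u v}.
- move=> u v s t x.
  have rel1 : ((gen s * gen t) ^+ m s t)%g = 1%g.
    rewrite -wprod_flatten_nseq -wprod_nil; apply/mrel.
    by have := cox_rel m [::] [::] s t; rewrite cats0.
  rewrite !reflections_cat !count_cat map_cat count_cat.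
  rewrite count_map_conj !oddD reflections_relation // addFb.
  rewrite wprod_flatten_nseq rel1 invg1; congr (_ (+) odd (count_mem _ _)).
  by congr map; rewrite -[RHS]map_id; apply: eq_map => y; rewrite mul1g mulg1.
- by [].
- by move=> u v _ IH x; rewrite IH.
- by move=> u v w _ IH1 _ IH2 x; rewrite IH1.
Qed.

Lemma reflections_mem (T : {set S}) u x :
  {subset u <= T} -> x \in reflections u ->
  exists2 v : seq S, {subset v <= T} & wp v = x.
Proof.
move=> + /(nthP 1%g)[i]; rewrite size_reflections => + iu.
elim: u i x iu => // s u IH [|i] x /= iu uT xE.
  exists [:: s]; last by rewrite wprod_gen.
  by move=> t /[!inE] /eqP->; apply: uT; rewrite mem_head.
move: xE; rewrite (nth_map 1%g) ?size_reflections // => <-.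
have uT' : {subset u <= T} by move=> t tu; apply: uT; rewrite inE tu orbT.
have [v vT vE] := IH i _ iu uT' erefl.
exists (s :: rcons v s); last by rewrite wprod_cons wprod_rcons vE mulgA.
have sT : s \in T by apply: uT; rewrite mem_head.
by move=> t; rewrite !(inE, mem_rcons) => /or3P[/eqP->|/eqP->|/vT].
Qed.

Lemma ex_reduced w : exists2 u, reduced gen u & wp u = w.
Proof.
have ex : exists n, `[< exists2 u, size u = n & wp u = w >].
  by have [u uw] := wprod_surj w; exists (size u); apply/asboolP; exists u.
case: (ex_minnP ex) => n /asboolP[u un uw] minn; exists u => // v.
by rewrite uw => vw; rewrite un; apply: minn; apply/asboolP; exists v.
Qed.

(** A reflection that occurs once in [u] occurs an odd number of times, hence at least once, in
    every word for the same element. *)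
Lemma reduced_uniq_reflections u :
  uniq (reflections u) -> reduced gen u.
Proof.
move=> uniq_u v vu; rewrite -(size_reflections u) -(size_reflections v).
apply: uniq_leq_size => // x xu.
have := wprod_reflections_odd x vu.
rewrite (count_uniq_mem _ uniq_u) xu /= => /esym.
by case: (boolP (x \in _)) => // /count_memPn ->.
Qed.

(* If two reflections of u coincide, the two corresponding letters cancel. *)
Lemma uniq_reflections_or_delete u : uniq (reflections u) \/
  exists v, [/\ subseq v u, (size v < size u)%N & wp v = wp u].
Proof.
elim: u => [|s u [IH|[v [vu sv vE]]]]; first by left.
- rewrite [uniq _]/= map_inj_uniq ?IH ?andbT; last first.
    by move=> x y /mulIg /mulgI.
  case: (boolP (_ \in _)) => [/mapP[t tu tE]|]; last by left.
  have {tE} tE : t = gen s.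
    move/(congr1 (fun x => gen s * x * gen s)%g): tE.
    by rewrite gen_sq mul1g !mulgA gen_sq mul1g mulgss.
  right; move: tu; rewrite {}tE.
  move/(nthP 1%g)=> [i]; rewrite size_reflections => iu.
  have -> : u = take i u ++ nth s u i :: drop i.+1 u.
    by rewrite -drop_nth // cat_take_drop.
  rewrite reflections_cat nth_cat size_reflections size_takel ?(ltnW iu) //.
  rewrite ltnn subnn => sE; rewrite /= in sE.
  set a := take i u in sE *; set b := drop _ _; set c := nth s u i in sE *.
  exists (a ++ b); split.
  + apply: (@subseq_trans _ (a ++ c :: b)); last exact: subseq_cons.
    exact: cat_subseq (subseq_refl _) (subseq_cons _ _).
  + by rewrite /= !size_cat /= addnS ltnS leqW.
  + by rewrite wprod_cons !wprod_cat wprod_cons -sE !mulgA mulgVK mulgss.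
- right; exists (s :: v); split=> //=; first by rewrite eqxx.
  by rewrite !wprod_cons vE.
Qed.

(** Cancelling letters shortens a word without leaving [T]. *)
Lemma parabolic_reduced (T : {set S}) w : parabolic gen T w ->
  exists u : seq S, [/\ reduced gen u, {subset u <= T} & wp u = w].
Proof.
case=> u uT <-; move: {2}(size u) (leqnn (size u)) => n.
elim: n u uT => [|n IH] u uT su.
  exists u; split=> // v _.
  by move: su; rewrite leqn0 => /eqP->.
have [/reduced_uniq_reflections ru|[v [vu sv vE]]] :=
  uniq_reflections_or_delete u; first by exists u.
rewrite -vE; apply: IH; last by rewrite -ltnS (leq_trans sv).
by move=> x /(mem_subseq vu) /uT.
Qed.

Lemma reduced_reflections_uniq u : reduced gen u -> uniq (reflections u).
Proof.
move=> ru; have [//|[v [_ sv /ru]]] := uniq_reflections_or_delete u.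
by rewrite leqNgt sv.
Qed.

Lemma reduced_rev u : reduced gen u -> reduced gen (rev u).
Proof.
move=> ru v vE; rewrite size_rev -(size_rev v); apply: ru.
by rewrite wprod_rev vE wprod_rev invgK.
Qed.

Lemma reduced_catl u v : reduced gen (u ++ v) -> reduced gen u.
Proof.
move=> ruv u' u'E; have := ruv (u' ++ v).
by rewrite !wprod_cat u'E !size_cat leq_add2r => ->.
Qed.

Lemma reduced_size u v : reduced gen u -> reduced gen v -> wp u = wp v ->
  size u = size v.
Proof.
by move=> ru rv uv; apply/eqP; rewrite eqn_leq ru ?rv.
Qed.

(** By parity the lengths of w and ws differ, so right multiplication by s either lengthens w or
    strips a final letter s from some reduced word of w. *)
Lemma reduced_rconsP u s : reduced gen u -> reduced gen (rcons u s) \/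
  exists v, [/\ reduced gen v, reduced gen (rcons v s),
                wp v = (wp u * gen s)%g & wp (rcons v s) = wp u].
Proof.
move=> ru; have [v rv vE] := ex_reduced (wp u * gen s)%g.
have vsE : wp (rcons v s) = wp u by rewrite wprod_rcons vE mulgss.
have /wprod_odd : wp v = wp (rcons u s) by rewrite vE wprod_rcons.
have ltuv := ru _ vsE; have ltvu := rv (rcons u s).
rewrite wprod_rcons vE !size_rcons in ltvu ltuv *.
have {}ltvu := ltvu erefl => oddv.
have [suv|suv] := ltnP (size u) (size v); [left|right].
  move=> x xE; rewrite size_rcons; apply: (leq_trans suv); apply: rv.
  by rewrite xE wprod_rcons vE.
exists v; split=> // x xE; rewrite size_rcons.
apply: (@leq_trans (size u)); last by apply: ru; rewrite xE.
move: suv; rewrite leq_eqVlt => /predU1P[suv|//].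
by move: oddv; rewrite suv /=; case: odd.
Qed.

End Words.

(** * The geometric representation and parabolic subgroups *)

Section GeometricRepresentation.

Variables (R : realType) (S : finType) (m : S -> S -> nat).

(* The entry m s t = 0, which stands for infinity, gives -1 as it should since
   pi / 0 = 0. *)
Definition tits_form (s t : S) : R := - cos (pi / (m s t)%:R).

Definition tits_pairing (s : S) (v : S -> R) : R := \sum_t tits_form s t * v t.

Definition tits_reflection (s : S) (v : S -> R) : S -> R :=
  fun t => v t - (if t == s then 2 * tits_pairing s v else 0).

Definition tits_action (u : seq S) (v : S -> R) : S -> R :=
  foldr tits_reflection v u.

(** The vector v + x e_s + y e_t. The orbit of [v] under the dihedral group of s and t stays in this
    form, so only [x] and [y] need tracking. *)
Definition shift2 (s t : S) (x y : R) (v : S -> R) : S -> R :=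
  fun r => v r + (r == s)%:R * x + (r == t)%:R * y.

Lemma tits_pairing_shift2 r s t x y v : tits_pairing r (shift2 s t x y v) =
  tits_pairing r v + tits_form r s * x + tits_form r t * y.
Proof.
have one w z : tits_form r w * z = \sum_i tits_form r i * ((i == w)%:R * z).
  rewrite (bigD1 w) //= eqxx mul1r big1 ?addr0 // => i /negPf->.
  by rewrite mul0r mulr0.
rewrite /tits_pairing !one -!big_split /=; apply: eq_bigr => i _.
by rewrite /shift2 !mulrDr.
Qed.

Lemma tits_reflection_shift2l s t x y v : tits_reflection s (shift2 s t x y v) =
  shift2 s t (x - 2 * tits_pairing s (shift2 s t x y v)) y v.
Proof.
apply/funext => r; rewrite /tits_reflection; set b := tits_pairing _ _.
by rewrite /shift2; case: (r == s); case: (r == t) => /=; ring.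
Qed.

Lemma tits_reflection_shift2r s t x y v : tits_reflection t (shift2 s t x y v) =
  shift2 s t x (y - 2 * tits_pairing t (shift2 s t x y v)) v.
Proof.
apply/funext => r; rewrite /tits_reflection; set b := tits_pairing _ _.
by rewrite /shift2; case: (r == s); case: (r == t) => /=; ring.
Qed.

Lemma tits_action_cat u u' v :
  tits_action (u ++ u') v = tits_action u (tits_action u' v).
Proof. exact: foldr_cat. Qed.

Lemma tits_action_notin u v s : s \notin u -> tits_action u v s = v s.
Proof.
elim: u => //= t u IH; rewrite inE negb_or => /andP[/negPf st su].
by rewrite /tits_reflection st subr0 IH.
Qed.

Hypothesis hm : coxeter_matrix m.

Lemma tits_form_diag s : tits_form s s = 1.
Proof. by case: hm => mss _ _; rewrite /tits_form mss divr1 cospi opprK. Qed.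

Lemma tits_form_sym s t : tits_form s t = tits_form t s.
Proof. by case: hm => _ ms _; rewrite /tits_form ms. Qed.

Lemma tits_reflectionK s : involutive (tits_reflection s).
Proof.
move=> v; have v0 : v = shift2 s s 0 0 v.
  by apply/funext => r; rewrite /shift2; ring.
rewrite [in LHS]v0 !tits_reflection_shift2l !tits_pairing_shift2.
rewrite tits_form_diag [RHS]v0; congr shift2; ring.
Qed.

(* In orthonormal coordinates where the basis vectors of s and t are (1, 0) and
   (- cos a, sin a), with a = pi / m, the orthogonal projection of v to their
   plane is (X, Y), and the product of the two reflections rotates it by 2a. *)
Lemma tits_rotation s t v k : s != t -> (1 < m s t)%N ->
  let a := pi / (m s t)%:R : R in
  let X := tits_pairing s v in
  let Y := (tits_pairing t v + X * cos a) / sin a in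
  let Xk := X * cos (k%:R * (2 * a)) - Y * sin (k%:R * (2 * a)) in
  let Yk := Y * cos (k%:R * (2 * a)) + X * sin (k%:R * (2 * a)) in
  tits_action (flatten (nseq k [:: s; t])) v =
  shift2 s t (Xk - X + (Yk - Y) * cos a / sin a) ((Yk - Y) / sin a) v.
Proof.
move=> st m2 a X Y; have sa : sin a != 0.
  rewrite gt_eqF // sin_gt0_pi // divr_gt0 ?pi_gt0 ?ltr0n ?(ltnW m2) //=.
  by rewrite ltr_pdivrMr ?ltr0n ?(ltnW m2) // ltr_pMr ?pi_gt0 // ltr1n.
have v0 : v = shift2 s t 0 0 v.
  by apply/funext => r; rewrite /shift2; ring.
elim: k => [|k IH] Xk Yk /=.
  rewrite [LHS]v0 /Xk /Yk mul0r cos0 sin0; congr shift2; field; exact: sa.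
rewrite IH tits_reflection_shift2r tits_reflection_shift2l.
rewrite !tits_pairing_shift2 !tits_form_diag (tits_form_sym t s).
have -> : tits_form s t = - cos a by [].
have angle : k.+1%:R * (2 * a) = k%:R * (2 * a) + (a + a).
  by rewrite -natr1; ring.
have {}Y0 : tits_pairing t v = Y * sin a - X * cos a.
  by rewrite /Y mulfVK //; ring.
rewrite /Xk /Yk angle !(cosD, sinD) Y0 -/X.
have c2 := cos2Dsin2 a.
have d2 : sin a ^+ 2 = 1 - cos a ^+ 2 by rewrite -c2 addrAC subrr add0r.
congr shift2.
  field: d2; exact: sa.
field: d2; exact: sa.
Qed.

Lemma tits_relation s t v :
  tits_action (flatten (nseq (m s t) [:: s; t])) v = v.
Proof.
have [mss ms mst] := hm.
have [<-|st] := eqVneq s t; first by rewrite mss /= tits_reflectionK.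
have [m0|m_gt0] := posnP (m s t); first by rewrite m0.
have m2 : (1 < m s t)%N by rewrite ltn_neqAle eq_sym mst.
rewrite tits_rotation //.
have -> : (m s t)%:R * (2 * (pi / (m s t)%:R)) = pi *+ 2 :> R.
  by rewrite mulr2n; field; rewrite pnatr_eq0 -lt0n.
rewrite cos2pi sin2pi !mulr0 !mulr1 subr0 addr0 !subrr !mul0r addr0.
by apply/funext => r; rewrite /shift2 !mulr0 !addr0.
Qed.

Lemma tits_action_equiv u u' v :
  cox_equiv m u u' -> tits_action u v = tits_action u' v.
Proof.
move=> uu'; elim: uu' v => {u u'} [u u' s t v|//|u u' _ IH v|u u1 u2 _ + _ + v].
- by rewrite !tits_action_cat tits_relation.
- by rewrite IH.
- by move=> -> ->.
Qed.

(** The reflection in s sends e_s to - e_s, whereas a word without s leaves the s-coordinate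
    alone. *)
Lemma cox_equiv_letter s u : cox_equiv m u [:: s] -> s \in u.
Proof.
move=> us; apply: contraT => /(tits_action_notin (fun t => (t == s)%:R)).
rewrite (tits_action_equiv _ us) /= /tits_reflection eqxx /tits_pairing.
rewrite (bigD1 s) //= big1 => [|t /negPf->]; last by rewrite mulr0.
rewrite eqxx tits_form_diag mulr1n addr0 mulr1 => E.
have /eqP : (2 : R) = 0 by lra.
by rewrite pnatr_eq0.
Qed.

End GeometricRepresentation.

(** * Standard parabolic subgroups *)

Section Parabolics.

Variables (R : realType) (W : groupType) (S : finType) (gen : S -> W).
Hypothesis hcox : coxeter_system gen.

Lemma parabolic1 (T : {set S}) : parabolic gen T 1%g.
Proof. by exists [::]; rewrite ?wprod_nil. Qed.

Lemma parabolic_gen (T : {set S}) s : parabolic gen T (gen s) <-> s \in T.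
Proof.
split=> [[u uT us]|sT]; last first.
  by exists [:: s]; rewrite ?wprod_gen // => t /[!inE] /eqP->.
have [m [hm _ mrel]] := hcox.
apply: uT; apply: (cox_equiv_letter R hm).
by apply/mrel; rewrite us wprod_gen.
Qed.

Lemma parabolicM (T : {set S}) w w' :
  parabolic gen T w -> parabolic gen T w' -> parabolic gen T (w * w')%g.
Proof.
move=> [u uT <-] [v vT <-]; exists (u ++ v); last by rewrite wprod_cat.
by move=> s /[!mem_cat] /orP[/uT|/vT].
Qed.

Lemma parabolicV (T : {set S}) w : parabolic gen T w -> parabolic gen T w^-1%g.
Proof.
move=> [u uT <-]; exists (rev u); last by rewrite (wprod_rev hcox).
by move=> s /[!mem_rev] /uT.
Qed.

Lemma parabolicS (T T' : {set S}) : T \subset T' ->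
  parabolic gen T `<=` parabolic gen T'.
Proof.
by move=> /fintype.subsetP TT' w [u uT <-]; exists u => // s /uT /TT'.
Qed.

(** The first letter s of a reduced word in [T] is one of its reflections. Hence it is a reflection
    of any reduced word in [T'] for the same element, so it lies in W_T' and s is in [T']. *)
Lemma parabolic_disjoint (T T' : {set S}) w : (T :&: T')%SET = finset.set0 ->
  parabolic gen T w -> parabolic gen T' w -> w = 1%g.
Proof.
move=> TT' /(parabolic_reduced hcox)[[|s u] [ru uT uw]].
  by rewrite -uw wprod_nil.
move=> /(parabolic_reduced hcox)[v [rv vT vw]].
have sT : s \in T by apply: uT; rewrite mem_head.
have := wprod_reflections_odd hcox (gen s) (etrans uw (esym vw)).
rewrite !count_uniq_mem ?(reduced_reflections_uniq hcox) // mem_head /=.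
move/esym.
case: (boolP (_ \in _)) => // sv _.
have /parabolic_gen sT' : parabolic gen T' (gen s).
  by have [x xT xE] := reflections_mem vT sv; exists x.
by move/finset.setP/(_ s): TT'; rewrite !inE sT sT'.
Qed.

Lemma sphericalS (T T' : {set S}) : T \subset T' ->
  spherical gen T' -> spherical gen T.
Proof. by move=> TT'; apply: sub_finite_set; exact: parabolicS. Qed.

Lemma spherical1 s : spherical gen [set s]%SET.
Proof.
apply: (@sub_finite_set _ _ [set 1%g; gen s]); last exact: finite_set2.
move=> _ [u us <-]; elim: u us => [|t u IH] us.
  by left; rewrite wprod_nil.
have /set1P-> : t \in [set s]%SET by apply: us; rewrite mem_head.
rewrite wprod_cons; case: IH => [x xu|->|->].
- by apply: us; rewrite inE xu orbT.
- by right; rewrite mulg1.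
- by left; rewrite (gen_sq hcox).
Qed.

Lemma spherical0 : spherical gen finset.set0.
Proof.
apply: (@sub_finite_set _ _ [set 1%g]); last exact: finite_set1.
move=> _ [[|s u] us <-]; first by rewrite wprod_nil.
by have := us s (mem_head _ _); rewrite inE.
Qed.

End Parabolics.

(** * Galleries and residues *)

Lemma card_eq_fsetE (T : choiceType) (A : set T) n :
  finite_set A -> (A #= `I_n)%card = (#|` fset_set A| == n)%fset.
Proof.
by move=> fA; rewrite -{1}(fset_setK fA); apply/card_eq_fsetP/eqP.
Qed.

Lemma card_fibers (T T' : choiceType) (A : set T) (B : set T') (f : T -> T')
    k m :
  (forall x, A x -> B (f x)) -> (B #= `I_m)%card ->
  (forall y, B y -> ([set x | A x /\ f x = y] #= `I_k)%card) ->
  (A #= `I_(m * k))%card.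
Proof.
move=> AB Bm fk.
have fB : finite_set B by apply/finite_setP; exists m.
have fF y : B y -> finite_set [set x | A x /\ f x = y].
  by move=> By; apply/finite_setP; exists k; exact: fk.
have fA : finite_set A.
  have -> : A = \bigcup_(y in B) [set x | A x /\ f x = y].
    apply/seteqP; split=> [x Ax|x [y _ []//]].
    by exists (f x); [exact: AB | ].
  exact: bigcup_finite.
rewrite card_eq_fsetE //; apply/eqP.
have -> : (#|` fset_set A| =
    \sum_(x <- fset_set A) \sum_(y <- fset_set B) (f x == y))%N.
  rewrite -sum1_size big_seq [RHS]big_seq; apply: eq_bigr => x.
  rewrite in_fset_set // inE => Ax.
  transitivity (count_mem (f x) (fset_set B)); last first.
    by rewrite -sum1_count big_mkcond; apply: eq_bigr => y _; rewrite /= eq_sym;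
      case: eqP.
  by rewrite count_uniq_mem ?fset_uniq // in_fset_set // mem_set //; exact: AB.
rewrite exchange_big /= big_seq.
rewrite (eq_bigr (fun=> k)) => [|y].
  rewrite -big_seq big_const_seq count_predT iter_addn_0 mulnC.
  by rewrite (card_fset_set Bm).
rewrite in_fset_set // inE => By.
rewrite -(card_fset_set (fk y By)).
transitivity (count [pred x | f x == y] (fset_set A)).
  by rewrite -sum1_count [RHS]big_mkcond; apply: eq_bigr => x _ /=; case: eqP.
rewrite -size_filter; apply/perm_size/uniq_perm.
- by rewrite filter_uniq ?fset_uniq.
- exact: fset_uniq.
move=> x; rewrite mem_filter !in_fset_set //; last exact: fF.
apply/andP/idP => [[/eqP fx /set_mem Ax]|/set_mem[Ax <-]].
  exact: mem_set.
by rewrite mem_set /=.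
Qed.

Lemma card_eq_setD1 (T : choiceType) (A : set T) x n :
  A x -> (A #= `I_n.+1)%card -> ([set y | A y /\ x <> y] #= `I_n)%card.
Proof.
move=> Ax An; have fA : finite_set A by apply/finite_setP; exists n.+1.
have -> : [set y | A y /\ x <> y] = A `\ x.
  by apply/seteqP; split=> y /= [Ay yx]; split=> // E; apply: yx.
rewrite card_eq_fsetE; last exact: finite_setD.
rewrite fset_setD1 //; apply/eqP.
have := card_fset_set An; rewrite (cardfsD1 x) in_fset_set // mem_set //.
by case.
Qed.

Section Galleries.

Variables (W : groupType) (S : finType) (gen : S -> W).
Hypothesis hcox : coxeter_system gen.
Variable C : building gen.

Local Notation wp := (wprod gen).

Lemma sequiv_refl s (c : C) : sequiv s c c.
Proof. by have [] := sequivP C s. Qed.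

Lemma sequiv_sym s (c c' : C) : sequiv s c c' -> sequiv s c' c.
Proof. by have [_ + _] := sequivP C s; apply. Qed.

Lemma sequiv_trans s (c c' c'' : C) :
  sequiv s c c' -> sequiv s c' c'' -> sequiv s c c''.
Proof. by have [_ _ +] := sequivP C s; apply. Qed.

Lemma sadj_sym s (c c' : C) : sadj s c c' -> sadj s c' c.
Proof. by move=> [/sequiv_sym cc' ne]; split=> // E; apply: ne. Qed.

Lemma gallery_cat u v (c c' : C) :
  gallery (u ++ v) c c' <-> exists c1, gallery u c c1 /\ gallery v c1 c'.
Proof.
elim: u c => [|s u IH] c /=.
  by split=> [?|[c1 [-> //]]]; exists c.
split=> [[c1 cc1 /IH[c2 [g1 g2]]]|[c2 [[c1 cc1 g1] g2]]].
  by exists c2; split=> //; exists c1.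
by exists c1 => //; apply/IH; exists c2.
Qed.

Lemma gallery_rcons u s (c c' : C) :
  gallery (rcons u s) c c' <-> exists c1, gallery u c c1 /\ sadj s c1 c'.
Proof.
rewrite -cats1 gallery_cat; split=> -[c1 [g]] /=.
  by move=> [c2 ? <-]; exists c1.
by move=> ?; exists c1; split=> //; exists c'.
Qed.

Lemma gallery_rev u (c c' : C) : gallery u c c' -> gallery (rev u) c' c.
Proof.
elim: u c => [|s u IH] c /= ; first by move=> ->.
by move=> [c1 /sadj_sym cc1 /IH g]; rewrite rev_cons gallery_rcons; exists c1.
Qed.

Lemma dW_gallery u (c c' : C) : reduced gen u ->
  dW c c' = wp u -> gallery u c c'.
Proof. by move=> ru /(building_gallery (b := C) c c' ru). Qed.

Lemma gallery_dW u (c c' : C) : reduced gen u ->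
  gallery u c c' -> dW c c' = wp u.
Proof. by move=> ru /(building_gallery (b := C) c c' ru). Qed.

Lemma dW_eq1 (c c' : C) : dW c c' = 1%g <-> c = c'.
Proof.
rewrite -[1%g](wprod_nil gen); split=> [/dW_gallery|cc']; first exact.
exact: gallery_dW.
Qed.

Lemma dW_sym (c c' : C) : dW c' c = (dW c c')^-1%g.
Proof.
have [u ru uE] := ex_reduced hcox (dW c c').
rewrite -uE -(wprod_rev hcox); apply: gallery_dW; first exact: reduced_rev.
exact/gallery_rev/dW_gallery.
Qed.

Lemma dW_adj_up u s (c c' c'' : C) : reduced gen u -> reduced gen (rcons u s) ->
  dW c c' = wp u -> sadj s c' c'' -> dW c c'' = wp (rcons u s).
Proof.
move=> ru rus cu cs; apply: gallery_dW => //; apply/gallery_rcons.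
by exists c'; split=> //; exact: dW_gallery.
Qed.

Lemma dW_adj_down u s (c c' : C) : reduced gen u -> reduced gen (rcons u s) ->
  dW c c' = wp (rcons u s) -> exists c1, sadj s c1 c' /\ dW c c1 = wp u.
Proof.
move=> ru rus /dW_gallery -/(_ rus)/gallery_rcons[c1 [g cs]].
by exists c1; split=> //; exact: gallery_dW.
Qed.

Lemma dW_sequiv s (c c' c'' : C) : sequiv s c' c'' ->
  dW c c'' = dW c c' \/ dW c c'' = (dW c c' * gen s)%g.
Proof.
move=> cs; have [<-|ne] := pselect (c' = c''); first by left.
have {cs ne}cs : sadj s c' c'' by [].
have [u ru uE] := ex_reduced hcox (dW c c'); rewrite -uE.
have [rus|[v [rv rvs vE vsE]]] := reduced_rconsP hcox s ru.
  by right; rewrite -wprod_rcons; apply: (dW_adj_up ru) cs; rewrite ?uE.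
have [c1 [c1c' c1E]] := dW_adj_down rv rvs (etrans (esym uE) (esym vsE)).
have [<-|ne] := pselect (c1 = c''); first by right; rewrite c1E vE.
left; rewrite -vsE; apply: (dW_adj_up rv rvs c1E).
by split=> //; apply: sequiv_trans c1c'.1 cs.1.
Qed.

Lemma gallery_parabolic (T : {set S}) u (c c' : C) :
  {subset u <= T} -> gallery u c c' -> parabolic gen T (dW c c').
Proof.
elim/last_ind: u c' => [|u s IH] c' uT.
  by move=> /= /dW_eq1->; exact: parabolic1.
move=> /gallery_rcons[c1 [g cs]].
have pc1 : parabolic gen T (dW c c1).
  by apply: IH g => x xu; apply: uT; rewrite mem_rcons inE xu orbT.
have [->//|->] := dW_sequiv c cs.1.
apply: parabolicM => //; exists [:: s]; last exact: wprod_gen.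
by move=> x /[!inE] /eqP->; apply: uT; rewrite mem_rcons mem_head.
Qed.

Lemma residueP (T : {set S}) (c c' : C) :
  residue T c c' <-> exists2 u : seq S, {subset u <= T} & gallery u c c'.
Proof.
split=> [|[u uT]]; last exact: gallery_parabolic.
move=> /(parabolic_reduced hcox)[u [ru uT uE]]; exists u => //.
exact: dW_gallery.
Qed.

Lemma residue_refl (T : {set S}) (c : C) : residue T c c.
Proof. by apply/residueP; exists [::]. Qed.

Lemma residue_sym (T : {set S}) (c c' : C) : residue T c c' -> residue T c' c.
Proof.
by move=> /(parabolicV hcox); rewrite -dW_sym.
Qed.

Lemma residue_trans (T : {set S}) (c c' c'' : C) :
  residue T c c' -> residue T c' c'' -> residue T c c''.
Proof.
move=> /residueP[u uT gu] /residueP[v vT gv]; apply/residueP; exists (u ++ v).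
  by move=> x /[!mem_cat] /orP[/uT|/vT].
by apply/gallery_cat; exists c'.
Qed.

Lemma residue_eq (T : {set S}) (c c' : C) :
  residue T c c' -> residue T c = residue T c'.
Proof.
move=> cc'; apply/seteqP; split=> x; apply: residue_trans => //.
exact: residue_sym.
Qed.

Lemma residueS (T T' : {set S}) (c : C) : (T \subset T')%SET ->
  residue T c `<=` residue T' c.
Proof. by move=> TT' c'; apply: parabolicS. Qed.

Lemma residue_sequiv (T : {set S}) s (c c' c'' : C) : s \in T ->
  residue T c c' -> sequiv s c' c'' -> residue T c c''.
Proof.
move=> sT cc' cs; have [<-//|ne] := pselect (c' = c'').
apply: residue_trans cc' _; apply/residueP; exists [:: s].
  by move=> x /[!inE] /eqP->.
by exists c''.
Qed.

Lemma residue_disjoint (R : realType) (T T' : {set S}) (c c' : C) :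
  (T :&: T')%SET = finset.set0 -> residue T c c' -> residue T' c c' -> c = c'.
Proof.
move=> TT' cT cT'; apply/dW_eq1.
exact: (parabolic_disjoint R hcox TT' cT cT').
Qed.

Section Regular.

Variable q : S -> nat.
Hypothesis hreg : regular_building C q.

(** Chambers at distance us fibre over those at distance u: the fibre over [y] is the s-panel of [y]
    without [y], of size q_s. *)
Lemma card_sphere (c : C) u : reduced gen u ->
  ([set c' | dW c c' = wp u] #= `I_(\prod_(s <- u) q s)%N)%card.
Proof.
elim/last_ind: u => [|u s IH] rus.
  rewrite big_nil (_ : [set c' | _] = [set c]); first exact: card_set1.
  apply/seteqP; split=> c' /=; rewrite wprod_nil; first by move/dW_eq1->.
  by move=> ->; exact/dW_eq1.
have ru : reduced gen u by move: rus; rewrite -cats1 => /reduced_catl.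
rewrite -cats1 big_cat big_seq1 cats1.
have [f fP] : {f : C -> C & forall c', dW c c' = wp (rcons u s) ->
    sadj s (f c') c' /\ dW c (f c') = wp u}.
  apply: (@choice _ _ (fun c' c1 => dW c c' = wp (rcons u s) ->
    sadj s c1 c' /\ dW c c1 = wp u)) => c'.
  have [/(dW_adj_down ru rus)[c1 c1P]|] := pselect (dW c c' = wp (rcons u s)).
    by exists c1.
  by exists c.
have neq : wp u <> wp (rcons u s).
  by move/(wprod_odd hcox); rewrite size_rcons /=; case: odd.
apply: (@card_fibers {classic C} {classic C} _ _ f); [|exact: IH|].
  by move=> c' /fP[].
move=> y /= yu.
rewrite (_ : [set x | _] = [set x : C | sequiv s y x /\ y <> x]).
  apply: (@card_eq_setD1 {classic C} [set x : C | sequiv s y x]).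
    exact: sequiv_refl.
  exact: hreg.
apply/seteqP; split=> x /=.
  by move=> [/fP[[]]] + + _ fx; rewrite fx.
move=> ys; have xE := dW_adj_up ru rus yu ys; split=> //.
have [fxs fxu] := fP _ xE.
(* Were [f x] another chamber of the panel of [y], it would be at distance us instead of u. *)
apply: contrapT => ne; apply: neq; rewrite -fxu.
apply: (dW_adj_up ru rus yu); split; last exact: nesym.
exact: sequiv_trans ys.1 (sequiv_sym fxs.1).
Qed.

Local Notation qw := (q_weight gen q).

(** Both sides count the chambers at distance [wp u] from a fixed chamber; this gives independence
    of the reduced word without braid moves. *)
Lemma q_weight_reduced u : reduced gen u -> qw (wp u) = (\prod_(s <- u) q s)%N.
Proof.
move=> ru; have [c] := building_inhabited C.
pose A := [set v | reduced gen v /\ wp v = wp u].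
have [rv vE] : A (xget [::] A) by apply: xgetPex; exists u.
apply/card_eq_II; rewrite /q_weight.
have := card_sphere c rv; rewrite vE => cv.
by rewrite -(card_eql cv) card_sphere.
Qed.

Lemma q_weight_rcons u s : reduced gen (rcons u s) ->
  qw (wp (rcons u s)) = (qw (wp u) * q s)%N.
Proof.
move=> rus.
have ru : reduced gen u by move: rus; rewrite -cats1 => /reduced_catl.
by rewrite !q_weight_reduced // -cats1 big_cat big_seq1.
Qed.

Lemma q_weight1 : qw 1%g = 1%N.
Proof. by rewrite -(wprod_nil gen) q_weight_reduced ?big_nil. Qed.

Lemma card_dW (c : C) w : ([set c' | dW c c' = w] #= `I_(qw w))%card.
Proof.
have [u ru <-] := ex_reduced hcox w.
by rewrite q_weight_reduced //; exact: card_sphere.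
Qed.

Lemma finite_residue (T : {set S}) (c : C) : spherical gen T ->
  finite_set (residue T c).
Proof.
move=> fT; have -> : residue T c =
    \bigcup_(w in parabolic gen T) [set c' | dW c c' = w].
  apply/seteqP; split=> [c' ?|c' [w Tw /= E]]; first by exists (dW c c').
  by rewrite /residue /= E.
by apply: bigcup_finite => // w _; apply/finite_setP; exists (qw w);
  exact: card_dW.
Qed.

End Regular.

End Galleries.

(** * The alternating weight *)

Lemma fsum_const (V : zmodType) (T : choiceType) (A : set T) n (a : V) :
  (A #= `I_n)%card -> \sum_(x \in A) a = a *+ n.
Proof.
move=> An; have fA : finite_set A by apply/finite_setP; exists n.
rewrite fsbig_finite // big_const_seq count_predT iter_addr_0.
by rewrite (card_fset_set An).
Qed.

Section AlternatingWeight.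

Variables (R : realType) (W : groupType) (S : finType) (gen : S -> W).
Hypothesis hcox : coxeter_system gen.
Variables (C : building gen) (q : S -> nat).
Hypotheses (hreg : regular_building C q) (hq : forall s, (2 <= q s)%N).

Local Notation wp := (wprod gen).
Local Notation qw := (q_weight gen q).

Definition alt_weight (w : W) : R :=
  (-1) ^+ size (xget [::] [set u | reduced gen u /\ wp u = w]) / (qw w)%:R.

Lemma q_weight_gt0 w : (0 < qw w)%N.
Proof. by apply: prodn_gt0 => s; exact: ltnW (hq s). Qed.

Lemma alt_weight_reduced u : reduced gen u ->
  alt_weight (wp u) = (-1) ^+ size u / (qw (wp u))%:R.
Proof.
move=> ru; rewrite /alt_weight; set A := [set v | _].
have [rv vE] : A (xget [::] A) by apply: xgetPex; exists u.
by rewrite (reduced_size rv ru vE).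
Qed.

Lemma alt_weight1 : alt_weight 1%g = 1.
Proof.
by rewrite -(wprod_nil gen) alt_weight_reduced // wprod_nil
  (q_weight1 hcox hreg) divr1.
Qed.

Lemma alt_weight_rcons u s : reduced gen u -> reduced gen (rcons u s) ->
  alt_weight (wp (rcons u s)) *+ q s = - alt_weight (wp u).
Proof.
move=> ru rus; rewrite !alt_weight_reduced // (q_weight_rcons hcox hreg) //.
rewrite size_rcons exprS natrM -[LHS]mulr_natr.
have := q_weight_gt0 (wp u); have := ltnW (hq s); rewrite !lt0n => q0 w0.
by field; rewrite !pnatr_eq0 q0 w0.
Qed.

Lemma norm_alt_weight w : `|alt_weight w| = (qw w)%:R^-1.
Proof. by rewrite /alt_weight normrM normrX normrN1 expr1n mul1r ger0_norm. Qed.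

Local Notation T := {classic C}.

Variable c0 : C.

Definition alt_chamber (c : T) : R := alt_weight (dW c0 (c : C)).

Definition panel s (c : T) : set T := [set c' : T | sequiv s (c : C) (c' : C)].

Lemma card_panel s c : (panel s c #= `I_(q s).+1)%card.
Proof. exact: hreg. Qed.

Lemma finite_panel s c : finite_set (panel s c).
Proof. by apply/finite_setP; exists (q s).+1; exact: card_panel. Qed.

(** [c1] is the projection of [c0] onto the s-panel of [c]. *)
Lemma panel_bottom s (c : T) : exists u (c1 : T),
  [/\ reduced gen u, reduced gen (rcons u s), dW c0 (c1 : C) = wp u &
      sequiv s (c : C) (c1 : C)].
Proof.
have [u ru uE] := ex_reduced hcox (dW c0 (c : C)).
have [rus|[v [rv rvs vE vsE]]] := reduced_rconsP hcox s ru.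
  by exists u, c; split=> //; exact: sequiv_refl.
have [c1 [c1c c1E]] := dW_adj_down rv rvs (etrans (esym uE) (esym vsE)).
by exists v, c1; split=> //; exact: sequiv_sym c1c.1.
Qed.

Lemma sum_panel s (c : T) : \sum_(c' \in panel s c) alt_chamber c' = 0.
Proof.
have [u [c1 [ru rus c1E cc1]]] := panel_bottom s c.
rewrite (fsbigD1 c1) //=; last exact: finite_panel.
have -> : panel s c `\ c1 = [set c' : T | panel s c1 c' /\ c1 <> c'].
  apply/seteqP; split=> c' [/= cc' ne]; split; try exact: nesym.
    exact: sequiv_trans (sequiv_sym cc1) cc'.
  exact: sequiv_trans cc1 cc'.
rewrite (eq_fsbigr (fun=> alt_weight (wp (rcons u s)))) => [|c'].
  have := card_eq_setD1 (A := panel s c1) (sequiv_refl s c1) (card_panel s c1).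
  move/fsum_const->.
  by rewrite alt_weight_rcons // /alt_chamber c1E subrr.
by rewrite inE => cs; congr alt_weight; exact: (dW_adj_up ru rus c1E).
Qed.

(* Double counting: every chamber of A lies in the panels of exactly q s + 1
   chambers of A. *)
Lemma sum_panel_closed s (A : set T) : finite_set A ->
  (forall c c', A c -> panel s c c' -> A c') ->
  \sum_(c \in A) alt_chamber c = 0.
Proof.
move=> fA clA.
have in_panel c : A c -> A `&` panel s c = panel s c.
  move=> Ac; apply/seteqP; split=> [c' []//|c' cc']; split=> //.
  exact: clA cc'.
have panel_sym c c' : (c \in panel s c') = (c' \in panel s c).
  by apply/idP/idP; rewrite !inE; exact: sequiv_sym.
have : \sum_(c \in A) \sum_(c' \in A)
    (if c' \in panel s c then alt_chamber c' else 0) = 0.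
  apply: fsbig1 => c Ac; rewrite -fsbig_mkcondr in_panel //; exact: sum_panel.
rewrite exchange_fsbig //.
rewrite (eq_fsbigr (fun c => alt_chamber c * (q s).+1%:R)) => [|c /set_mem Ac].
  rewrite -mulr_fsuml => /eqP; rewrite mulf_eq0 pnatr_eq0 orbF.
  by move/eqP.
under eq_fsbigr do rewrite panel_sym.
rewrite -fsbig_mkcondr in_panel //.
by rewrite (fsum_const _ (card_panel s c)) mulr_natr.
Qed.

End AlternatingWeight.

(** * Summability *)

Section Sums.

Variable R : realType.
Local Open Scope ereal_scope.

Lemma esum_fibers (T T' : choiceType) (h : T -> T') (a : T -> \bar R) :
  (forall x, 0 <= a x) ->
  \esum_(x in setT) a x = \esum_(y in setT) \esum_(x in h @^-1` [set y]) a x.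
Proof.
move=> a0; rewrite esum_esum //.
apply/esym/(reindex_esum setT _ (fun x => (h x, x)) (fun k => a k.2)).
by split=> [x _ //|x y _ _ [_ ->] //|[y x] [_ /= <-]]; exists x.
Qed.

Lemma esum_cst (T : choiceType) (A : set T) n (x : R) : (0 <= x)%R ->
  (A #= `I_n)%card -> \esum_(i in A) x%:E = (x *+ n)%:E.
Proof.
move=> x0 An; have fA : finite_set A by apply/finite_setP; exists n.
by rewrite esum_fset // fsumEFin // (fsum_const _ An).
Qed.

Lemma esum_geometric (a : nat -> R) (M r : R) N :
  (0 <= M)%R -> (0 < r < 1)%R -> (forall n, 0 <= a n)%R ->
  (forall n, (N <= n)%N -> (a n <= M * r ^+ n)%R) ->
  \esum_(n in setT) (a n)%:E < +oo.
Proof.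
move=> M0 /andP[r0 r1] a0 ar.
(* The added terms absorb the first [N] values, so that the geometric bound holds for every
   index. *)
pose K : R := (M + \sum_(i < N) a i / r ^+ i)%R.
have K0 : (0 <= K)%R.
  by rewrite addr_ge0 ?sumr_ge0 // => *; rewrite divr_ge0 // exprn_ge0 // ltW.
have aK n : (a n <= K * r ^+ n)%R.
  rewrite mulrDl; have [Nn|nN] := leqP N n.
    apply: ler_wpDr.
      by rewrite mulr_ge0 ?exprn_ge0 ?(ltW r0) ?sumr_ge0 // => *;
         rewrite divr_ge0 // exprn_ge0 // ltW.
    exact: ar.
  apply: ler_wpDl.
    by rewrite mulr_ge0 // exprn_ge0 // ltW.
  rewrite (bigD1 (Ordinal nN)) //= mulrDl divfK ?expf_neq0 ?gt_eqF //.
  rewrite ler_wpDr //.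
  by rewrite mulr_ge0 ?exprn_ge0 ?(ltW r0) ?sumr_ge0 // => *;
     rewrite divr_ge0 // exprn_ge0 // ltW.
rewrite -nneseries_esumT; last by move=> n; rewrite lee_fin.
apply: (@le_lt_trans _ _ (K / (1 - r))%:E); last exact: ltry.
apply: lime_le; first by apply: is_cvg_nneseries => n _ _; rewrite lee_fin.
near=> n; rewrite sumEFin lee_fin.
have rn : (`|r| < 1)%R by rewrite gtr0_norm.
apply: le_trans _ (geometric_le_lim n K0 r0 rn).
by apply: ler_sum => i _; exact: aK.
Unshelve. all: by end_near.
Qed.

End Sums.

(** * Growth and convergence of the weight series *)

Section Growth.

Variables (R : realType) (W : groupType) (S : finType) (gen : S -> W).
Hypothesis hcox : coxeter_system gen.
Variables (C : building gen) (q : S -> nat).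
Hypotheses (hreg : regular_building C q) (hq : forall s, (2 <= q s)%N).

Local Notation qw := (q_weight gen q).

Definition weight_ball (n : nat) : set W :=
  [set w : W | (qw w)%:R <= expR (n%:R : R)].

Lemma finite_seq_size N : finite_set [set u : seq S | (size u <= N)%N].
Proof.
have -> : [set u : seq S | (size u <= N)%N] =
    [set val t | t in [set: {: N.-bseq S}]].
  apply/seteqP; split=> u /=; last by move=> [t _ <-]; exact: size_bseq.
  by move=> uN; exists (Bseq uN).
by apply: finite_image; exact: finite_finset.
Qed.

(** As all q_s are at least 2, q_w is at least 2^l(w), which bounds the length on a ball. *)
Lemma finite_weight_ball n : finite_set (weight_ball n).
Proof.
have [N hN] : exists N, expR (n%:R : R) < N%:R.
  by exists (Num.truncn (expR (n%:R : R))).+1; exact: truncnS_gt.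
apply: (@sub_finite_set _ _
  [set wprod gen u | u in [set u : seq S | (size u <= N)%N]]).
  move=> w /= wn; have [u ru uE] := ex_reduced hcox w; exists u => //=.
  have : (qw w)%:R < N%:R :> R by exact: le_lt_trans hN.
  rewrite ltr_nat -uE (q_weight_reduced hcox hreg) // => uN.
  apply: ltnW; apply: leq_trans uN; rewrite ltnS.
  apply: (@leq_trans (2 ^ size u)); first exact/ltnW/ltn_expl.
  elim: (u) => [|s v IH]; first by rewrite big_nil.
  by rewrite big_cons /= expnS leq_mul.
exact/finite_image/finite_seq_size.
Qed.

Lemma card_weight_ball n :
  (weight_ball n #= `I_(cardinal (weight_ball n)))%card.
Proof.
have /finite_setP[k bk] := finite_weight_ball n.
exact: (xgetPex 0%N (ex_intro [set k | (weight_ball n #= `I_k)%card] k bk)).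
Qed.

Lemma cardinal_weight_ball_gt0 n : (0 < cardinal (weight_ball n))%N.
Proof.
rewrite lt0n; apply/eqP => E; have := card_weight_ball n; rewrite E.
rewrite II0 card_eq0 => /eqP/seteqP[/(_ 1%g) + _]; apply.
rewrite /weight_ball /= (q_weight1 hcox hreg).
by rewrite -expR0 ler_expR.
Qed.

Lemma growth_lt (e : R) : (growth R gen q < e%:E)%E -> exists N, forall n,
  (N <= n)%N -> (cardinal (weight_ball n))%:R < expR (n%:R * e).
Proof.
(* The successor keeps [n] positive, so that the factor 1/n can be cleared. *)
move=> /ereal_inf_lt[_ [V [N _ NV] <-]] sup_lt; exists N.+1 => n Nn.
have Vn : V n by apply: NV; exact: ltnW.
have := le_lt_trans (ereal_sup_ubound (imageP _ Vn)) sup_lt.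
rewrite lte_fin -/(weight_ball n) => lt_e.
have n0 : 0 < n%:R :> R by rewrite ltr0n (leq_trans _ Nn).
rewrite -[ltLHS]lnK ?posrE ?ltr0n ?cardinal_weight_ball_gt0 // ltr_expR.
by rewrite -ltr_pdivrMl.
Qed.

Variable p : R.
Hypothesis hp : (1 + growth R gen q < p%:E)%E.

Lemma growth_gap : exists2 e : R, (growth R gen q < e%:E)%E & e < p - 1.
Proof.
case: (growth R gen q) hp => [g| |] //=.
- rewrite lte_fin => gp; exists ((g + (p - 1)) / 2).
    by rewrite lte_fin; lra.
  by lra.
(* For growth -oo any real below p - 1 will do. *)
- by exists (p - 2); rewrite ?ltNyr //; lra.
Qed.

(** Otherwise the gap exponent [e] would be negative and large balls would have fewer than one
    element, though they contain 1. *)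
Lemma growth_exponent_gt1 : 1 < p.
Proof.
have [e /growth_lt[N lt_e] ep] := growth_gap.
have := lt_e N.+1 (leqnSn N).
rewrite -subr_gt0; apply: contraPlt => le0.
apply/negP; rewrite -leNgt; apply: (@le_trans _ _ 1).
  by rewrite -expR0 ler_expR mulr_ge0_le0 //; exact: ltW (lt_le_trans ep le0).
by rewrite ler1n cardinal_weight_ball_gt0.
Qed.

Lemma q_weight_powR w (n : nat) : n%:R <= ln ((qw w)%:R : R) ->
  ((qw w)%:R^-1 `^ p) *+ qw w <= expR (- (p - 1) * n%:R).
Proof.
move=> nw; have w0 := q_weight_gt0 gen hq w.
set Q : R := (qw w)%:R in nw *; have Q0 : 0 < Q by rewrite ltr0n.
rewrite -mulr_natr -/Q /powR invr_eq0 (gt_eqF Q0) lnV ?posrE //.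
rewrite -{2}(lnK Q0) -expRD ler_expR.
have := growth_exponent_gt1; nra.
Qed.

(** Group [w] by n, the integer part of ln q_w. Such [w] lie in the ball of radius n + 1, so
    eventually there are at most exp(e (n + 1)) of them, each contributing at most exp(- (p - 1) n).
    The layers are dominated by a geometric series of ratio exp(e - (p - 1)) < 1; the shift to n + 1
    costs the constant exp(e). *)
Lemma summable_q_weight :
  (\esum_(w in [set: W]) (((qw w)%:R^-1 `^ p) *+ qw w)%:E < +oo :> \bar R)%E.
Proof.
have [e /growth_lt[N lt_e] ep] := growth_gap.
pose h (w : W) := Num.truncn (ln ((qw w)%:R : R)).
have ln0 w : 0 <= ln ((qw w)%:R : R).
  by rewrite ln_ge0 // ler1n q_weight_gt0.
rewrite (esum_fibers h); last first.
  by move=> w; rewrite lee_fin mulrn_wge0 // powR_ge0.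
pose a (n : nat) := expR (- (p - 1) * n%:R) *+ cardinal (weight_ball n.+1).
apply: (@le_lt_trans _ _ (\esum_(n in setT) (a n)%:E)%E).
  apply: le_esum => n _.
  rewrite -(esum_cst _ (card_weight_ball n.+1)) ?expR_ge0 //.
  rewrite esum_mkcond [leRHS]esum_mkcond; apply: le_esum => w _.
  case: ifPn => [/set_mem /= hw|_]; last first.
    by case: ifP => // _; rewrite lee_fin expR_ge0.
  have /andP[nw wn] := truncn_itv (ln0 w); rewrite -/(h w) hw in nw wn.
  rewrite ifT; first by rewrite lee_fin q_weight_powR.
  rewrite inE /weight_ball /= -[leLHS]lnK ?posrE ?ltr0n ?q_weight_gt0 //.
  by rewrite ler_expR ltW.
apply: (@esum_geometric _ a (expR e) (expR (e - (p - 1))) N).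
- exact: expR_ge0.
- by rewrite expR_gt0 expR_lt1 subr_lt0.
- by move=> n; rewrite mulrn_wge0 // expR_ge0.
- move=> n Nn; rewrite -expRM_natr -expRD.
  have -> : a n = expR (- (p - 1) * n%:R) * (cardinal (weight_ball n.+1))%:R.
    by rewrite mulr_natr.
  apply: le_trans (ler_wpM2l (expR_ge0 _) (ltW (lt_e n.+1 (leqW Nn)))) _.
  by rewrite -expRD ler_expR -natr1; lra.
Qed.

Lemma summable_alt_chamber (c0 : C) :
  (\esum_(c in [set: {classic C}])
     (`|alt_chamber R q c0 c| `^ p)%:E < +oo)%E.
Proof.
rewrite (esum_fibers (fun c : {classic C} => dW c0 (c : C))); last first.
  by move=> c; rewrite lee_fin powR_ge0.
apply: le_lt_trans summable_q_weight; apply: le_esum => w _.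
rewrite -(esum_cst (T := {classic C}) _ (card_dW hcox hreg c0 w)) ?powR_ge0 //.
apply: le_esum => c /= <-.
by rewrite /alt_chamber norm_alt_weight.
Qed.

End Growth.

(** * Simplicial chains *)

Section SimplicialChains.

Variables (R : realType) (n : nat).
Implicit Types (K Q J : {set {set 'I_n}}) (x y : {set 'I_n})
  (a b : {set 'I_n} -> R).

Local Notation inc := (@simplex_inc R n).
Local Notation rank v x := #|[pred u in x | (u < v)%N]|.

(* The augmented boundary: bd a set0 is the sum of the coefficients of a on
   vertices.  The unaugmented one is rbd below. *)
Definition bd a y : R := \sum_x inc x y * a x.

Lemma simplex_inc_face x y : inc x y != 0 -> y \subset x /\ #|x| = #|y|.+1.
Proof.
apply: contra_neqP => nface; apply: big1 => v /andP[vx /eqP yE].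
by case: nface; rewrite yE subD1set (cardsD1 v x) vx.
Qed.

(** Removing two vertices in the two possible orders gives opposite signs, so the sum equals its own
    opposite. *)
Lemma simplex_inc_comp x y :
  \sum_w inc x w * inc w y = 0.
Proof.
pose s (v u : 'I_n) : R := (-1) ^+ rank v x * (-1) ^+ rank u (x :\ v)%SET.
pose p (v u : 'I_n) := [&& v \in x, u \in x, u != v &
  y == (x :\ v :\ u)%SET].
have -> : \sum_w inc x w * inc w y = \sum_v \sum_u if p v u then s v u else 0.
  transitivity (\sum_w \sum_(v in x | w == (x :\ v)%SET)
      (-1) ^+ rank v x * inc w y).
    by apply: eq_bigr => w _; rewrite mulr_suml.
  rewrite (exchange_big_dep (mem x)) /=; last by move=> w v _ /andP[].
  rewrite big_mkcond; apply: eq_bigr => v _; case: ifP => vx; last first.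
    by rewrite big1 // => u _; rewrite /p vx.
  rewrite (eq_bigl (pred1 (x :\ v)%SET)); last by move=> w; rewrite /= vx.
  rewrite big_pred1_eq mulr_sumr big_mkcond; apply: eq_bigr => u _.
  by rewrite /p vx !inE; case: (u \in x); case: (u == v); case: (y == _).
have sN v u : p v u -> s v u = - s u v.
  move=> /and4P[vx ux uv _].
  have rankD w z : w \in x ->
      rank z x = ((w < z) + rank z (x :\ w)%SET)%N.
    move=> wx; have [wz|wz] := ltnP w z.
      rewrite (cardD1 w) inE wx wz add1n; congr _.+1; apply: eq_card => i.
      by rewrite !inE andbA.
    apply: eq_card => i; rewrite !inE; case: eqP => // ->.
    by rewrite ltnNge wz andbF.
  rewrite /s -!exprD (rankD u v ux) (rankD v u vx).
  move: uv; rewrite -val_eqE /= neq_ltn => /orP[uv|vu].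
  - by rewrite uv ltnNge (ltnW uv) /= !exprD expr1 expr0; ring.
  - by rewrite vu ltnNge (ltnW vu) /= !exprD expr1 expr0; ring.
have pC v u : p v u = p u v.
  by rewrite /p andbCA (eq_sym u v) !finset.setDDl finset.setUC.
set t := LHS; suff : t = - t by lra.
rewrite {1}/t exchange_big /t -sumrN; apply: eq_bigr => v _.
rewrite -sumrN; apply: eq_bigr => u _; rewrite pC; case: ifP => [/sN->|_].
  by rewrite opprK.
by rewrite oppr0.
Qed.

Lemma bdD a b c y : bd (fun x => a x + c * b x) y = bd a y + c * bd b y.
Proof.
rewrite /bd mulr_sumr -big_split; apply: eq_bigr => x _ /=.
by rewrite mulrDr mulrCA.
Qed.

Lemma bd0 y : bd (fun=> 0) y = 0.
Proof. by apply: big1 => x _; rewrite mulr0. Qed.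

Lemma bd_bd a y : bd (bd a) y = 0.
Proof.
rewrite /bd; under eq_bigr do rewrite mulr_sumr.
rewrite exchange_big big1 //= => x _.
under eq_bigr do rewrite mulrA [_ * inc x _]mulrC.
by rewrite -mulr_suml simplex_inc_comp mul0r.
Qed.

Lemma bd_neq0 a y : bd a y != 0 ->
  exists x, [/\ a x != 0, y \subset x & #|x| = #|y|.+1].
Proof.
move=> ne; apply: contrapT => nex; move/eqP: ne; apply; apply: big1 => x _.
apply/eqP; rewrite mulf_eq0; apply: contraT; rewrite negb_or.
by move=> /andP[/simplex_inc_face[yx xy] ax]; case: nex; exists x.
Qed.

Definition rbd a : {set 'I_n} -> R :=
  fun y => if y == finset.set0 then 0 else bd a y.

Lemma rbdD a b c :
  rbd (fun x => a x + c * b x) = fun y => rbd a y + c * rbd b y.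
Proof.
by apply/funext => y; rewrite /rbd bdD; case: ifP; rewrite // mulr0 addr0.
Qed.

Lemma rbd0 : rbd (fun=> 0) = fun=> 0.
Proof. by apply/funext => y; rewrite /rbd bd0 if_same. Qed.

Lemma rbd_rbd a : rbd (rbd a) = fun=> 0.
Proof.
apply/funext => y; rewrite /rbd; case: eqP => // y0.
rewrite -[RHS](bd_bd a y); apply: eq_bigr => x _.
case: eqP => [->|//]; rewrite /simplex_inc big_pred0 ?mul0r // => v.
by rewrite inE.
Qed.

Lemma rbd_neq0 a y : rbd a y != 0 ->
  exists x, [/\ a x != 0, y \subset x, #|x| = #|y|.+1 & y != finset.set0].
Proof.
rewrite /rbd; have [_|y0] := eqVneq y finset.set0; first by rewrite eqxx.
by move=> /bd_neq0[x [ax yx xy]]; exists x.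
Qed.

(** Expresses the boundary by a formula free of [K], so that chains of a complex and of a subcomplex
    can be compared directly. *)
Lemma boundary_simplicial K k a : simplicial_complex K ->
  chain (X := simplicial_cells R K) k a ->
  boundary (X := simplicial_cells R K) a = rbd a.
Proof.
move=> scK ca; apply/funext => y; rewrite /boundary patchE.
have -> : \sum_(x \in cells (simplicial_cells R K)) inc x y * a x = bd a y.
  rewrite /bd [RHS](bigID (mem K)) /= [X in _ = _ + X]big1 ?addr0; last first.
    move=> x xK; have [->|/ca[xK' _]] := eqVneq (a x) 0; first by rewrite mulr0.
    by rewrite xK' in xK.
  apply/esym; apply: (@bigfs _ 0 _ _ (index_enum _) (mem K)).
    exact: index_enum_uniq.
  by move=> x _; rewrite mem_index_enum.
case: ifPn => [/set_mem /= yK|yK].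
  by rewrite /rbd ifN //; have [] := scK _ yK.
apply/esym/eqP; apply: contraNT yK => /rbd_neq0[x [ax yx _ y0]].
by apply/mem_set => /=; have [/= xK _] := ca _ ax; have [_ ->] := scK _ xK.
Qed.

Lemma is_boundary_simplicial K k a : simplicial_complex K ->
  is_boundary (X := simplicial_cells R K) k a <->
  exists2 b, chain (X := simplicial_cells R K) k.+1 b & rbd b = a.
Proof.
move=> scK; split=> -[b cb bE]; exists b => //.
  by rewrite -(boundary_simplicial scK cb).
by rewrite (boundary_simplicial scK cb).
Qed.

End SimplicialChains.

(** * Collapsing the top dimension *)

Section Collapse.

Variables (R : realType) (n d : nat).
Variables (Q : {set {set 'I_n}}) (L : set {set 'I_n}).
Hypothesis d_gt0 : (0 < d)%N.
Hypothesis scQ : simplicial_complex Q.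
Hypothesis acQ : acyclic R Q.
Hypothesis dimQ : forall x, x \in Q -> (#|x| <= d.+1)%N.
Hypothesis LQ : L `<=` [set x | x \in Q].
Hypothesis dimL : forall x, L x -> (#|x| <= d)%N.

Implicit Types (J K : {set {set 'I_n}}) (x y : {set 'I_n})
  (a b z v : {set 'I_n} -> R).

Local Notation ch K := (chain (X := simplicial_cells R K)).

Lemma chain_lin K k a b c : ch K k a -> ch K k b ->
  ch K k (fun x => a x + c * b x).
Proof.
move=> ca cb x; have [a0|/ca//] := eqVneq (a x) 0.
have [b0|/cb//] := eqVneq (b x) 0.
by rewrite a0 b0 mulr0 addr0 eqxx.
Qed.

Lemma chain0 K k : ch K k (fun=> 0).
Proof. by move=> x; rewrite eqxx. Qed.

Lemma chain_rbd k a : ch Q k.+1 a -> ch Q k (rbd a).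
Proof.
move=> ca y /rbd_neq0[x [/ca[/= xQ xk] yx xy y0]].
by have [_ ->] := scQ xQ; rewrite // -[k]/(k.+1.-1) -xk xy.
Qed.

(** The rows of the boundary matrix indexed by [J] have full column rank on d-chains. *)
Definition detecting J := forall z, ch Q d z ->
  (forall y, y \in J -> bd z y = 0) -> z = fun=> 0.

Definition outer_faces : {set {set 'I_n}} :=
  [set y in Q | (#|y| == d) && ~~ `[< L y >]]%SET.

(** This is H_d(Q, L) = 0, since [Q] has no (d+1)-simplices and [L] no d-simplices. *)
Hypothesis rel_inj : forall z, ch Q d z ->
  (forall y, y \in Q -> ~ L y -> bd z y = 0) -> z = fun=> 0.

Lemma detecting_outer_faces : detecting outer_faces.
Proof.
move=> z cz z0; apply: rel_inj => // y yQ yL.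
apply/eqP; apply: contraT => ne; have [x [/cz[_ /= xd] _ xy]] := bd_neq0 ne.
move: ne; rewrite z0 ?eqxx // inE yQ -xd xy eqxx /=.
exact/asboolPn.
Qed.

(** Minimality yields a dual basis: dropping [j] lets some nonzero chain escape detection, its
    boundary at [j] is then nonzero, and rescaling makes it 1. *)
Lemma minimal_detecting : exists J, [/\ J \subset outer_faces, detecting J &
  forall j, j \in J -> exists z, [/\ ch Q d z, bd z j = 1 &
    forall y, y \in J -> y != j -> bd z y = 0]].
Proof.
pose P J := (J \subset outer_faces) && `[< detecting J >].
have P0 : P outer_faces.
  by rewrite /P fintype.subxx /=; apply/asboolP/detecting_outer_faces.
have [J /minsetP[/andP[JB /asboolP dJ] Jmin] _] := minset_exists P0.
exists J; split=> // j jJ.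
have : ~ detecting (J :\ j)%SET.
  move=> dJj; have := Jmin (J :\ j)%SET; rewrite subD1set => /(_ _ isT) E.
  have : j \in (J :\ j)%SET.
    rewrite E // /P (fintype.subset_trans (subD1set _ _) JB) /=.
    exact/asboolP.
  by rewrite !inE eqxx.
move=> /existsNP[z /not_implyP[cz /not_implyP[z0 zn0]]].
have zj : bd z j != 0.
  apply: contra_notN zn0 => /eqP zj; apply: dJ => // y yJ.
  by have [->//|yj] := eqVneq y j; apply: z0; rewrite !inE yj.
exists (fun x => 0 + (bd z j)^-1 * z x); split.
- by apply: chain_lin => //; exact: chain0.
- by rewrite bdD bd0 add0r mulVf.
- move=> y yJ yj; rewrite bdD bd0 add0r.
  by have -> : bd z y = 0; [apply: z0; rewrite !inE yj|rewrite mulr0].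
Qed.

Lemma detecting_lift J (g : {set 'I_n} -> R) :
  (forall j, j \in J -> exists z, [/\ ch Q d z, bd z j = 1 &
    forall y, y \in J -> y != j -> bd z y = 0]) ->
  exists2 v, ch Q d v & forall j, j \in J -> bd v j = g j.
Proof.
move=> hJ; suff: forall s : seq {set 'I_n}, uniq s -> {subset s <= J} ->
    exists2 v, ch Q d v & forall j, j \in J ->
      bd v j = if j \in s then g j else 0.
  move=> /(_ (enum J) (enum_uniq _)) []; first by move=> x; rewrite mem_enum.
  by move=> v cv vE; exists v => // j jJ; rewrite vE // mem_enum jJ.
elim=> [|i s IH] /=.
  by move=> _ _; exists (fun=> 0); [exact: chain0|move=> j _; rewrite bd0].
move=> /andP[is_ us] sJ; have iJ : i \in J by apply: sJ; rewrite mem_head.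
have [|v cv vE] := IH us; first by move=> x xs; apply: sJ; rewrite inE xs orbT.
have [z [cz zi z0]] := hJ _ iJ.
exists (fun x => v x + g i * z x); first exact: chain_lin.
move=> j jJ; rewrite bdD vE // inE; have [->|ji] := eqVneq j i.
  by rewrite (negPf is_) zi mulr1 add0r.
by rewrite z0 // mulr0 addr0.
Qed.

Section Subcomplex.

Variable J : {set {set 'I_n}}.
Hypotheses (JB : J \subset outer_faces) (dJ : detecting J).
Hypothesis hJ : forall j, j \in J -> exists z, [/\ ch Q d z, bd z j = 1 &
  forall y, y \in J -> y != j -> bd z y = 0].

Definition collapsed : {set {set 'I_n}} :=
  [set x in Q | (#|x| <= d)%N && (x \notin J)]%SET.

Local Notation K := collapsed.

Lemma outerP y : y \in J -> [/\ y \in Q, #|y| = d & ~ L y].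
Proof.
move/(fintype.subsetP JB); rewrite inE => /and3P[yQ /eqP yd yL].
by split=> //; exact/asboolPn.
Qed.

(** Once the d-simplices are gone, the members of [J], of dimension d - 1, are faces of nothing
    else. *)
Lemma collapsed_complex : simplicial_complex K.
Proof.
move=> x; rewrite inE => /and3P[xQ xd xJ]; have [x0 xf] := scQ xQ.
split=> // y yx y0; rewrite inE xf // (leq_trans (subset_leq_card yx) xd) /=.
apply: contra xJ => yJ; have [_ yd _] := outerP yJ.
suff <- : y = x by [].
by apply/eqP; rewrite eqEcard yx yd.
Qed.

Lemma collapsed_sub x : L x -> x \in K.
Proof.
move=> Lx; rewrite inE LQ // dimL //=.
by apply/negP => /outerP[_ _].
Qed.

Lemma chain_sub k a : ch K k a -> ch Q k a.
Proof.
by move=> ca x /ca[/= xK xk]; split=> //; move: xK; rewrite inE => /andP[].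
Qed.

(** Only k = d - 1 requires a correction: a d-chain whose boundary agrees with [a] on [J] is
    provided by the dual basis. *)
Lemma chain_push k a : (k < d)%N -> ch Q k a -> exists2 v,
  ch Q k.+1 v & ch K k (fun x => a x + -1 * rbd v x).
Proof.
move=> kd ca; move: (kd); rewrite leq_eqVlt => /orP[/eqP kE|kd1].
  have [v cv vE] := detecting_lift a hJ.
  exists v; first by rewrite kE.
  have cav : ch Q k (fun x => a x + -1 * rbd v x).
    by apply: chain_lin => //; apply: chain_rbd; rewrite kE.
  move=> x ne; have [/= xQ xk] := cav x ne; split=> //=.
  have [x0 _] := scQ xQ.
  rewrite inE xQ -kE -xk prednK ?card_gt0 // leqnn /=.
  by apply: contra ne => xJ; rewrite /rbd (negPf x0) vE // mulN1r subrr.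
exists (fun=> 0); first exact: chain0.
move=> x; rewrite rbd0 mulr0 addr0 => ax; have [/= xQ xk] := ca x ax.
have [x0 _] := scQ xQ; have xk1 : #|x| = k.+1.
  by rewrite -xk prednK // card_gt0.
split=> //=; rewrite inE xQ xk1 ltnW //=.
by apply/negP => /outerP[_ xd _]; rewrite -xd xk1 ltnn in kd1.
Qed.

(** Below degree d, push [a] into the subcomplex. In degree d, the boundary of [a] misses [J], so
    [a] vanishes by detection. Above d there are no simplices. *)
Lemma chain_fill k a : ch Q k.+1 a -> ch K k (rbd a) ->
  exists2 b, ch K k.+1 b & rbd b = rbd a.
Proof.
move=> ca cra; have [kd|dk] := ltnP k.+1 d.
  have [v cv cav] := chain_push kd ca.
  exists (fun x => a x + -1 * rbd v x) => //.
  by rewrite rbdD rbd_rbd; apply/funext => y; rewrite mulr0 addr0.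
suff a0 : a = fun=> 0 by exists a => //; rewrite a0; exact: chain0.
move: dk; rewrite leq_eqVlt => /orP[/eqP dk|dk].
  apply: dJ; first by rewrite dk.
  move=> y yJ; apply/eqP; apply: contraT => ne.
  have [yQ _ _] := outerP yJ; have [y0 _] := scQ yQ.
  have := cra y; rewrite /rbd (negPf y0) => /(_ ne)[/=].
  by rewrite inE yJ /= !andbF.
apply/funext => x; apply/eqP; apply: contraT => /ca[/= xQ xk].
have := dimQ xQ; rewrite leqNgt => /negP[]; rewrite -ltn_predRL xk; exact: dk.
Qed.

(** [chain_push] moves the generator of H_0 into the subcomplex, and [chain_fill] turns a bounding
    chain in [Q] into one in the subcomplex. *)
Lemma collapsed_acyclic : acyclic R K.
Proof.
have scK := collapsed_complex; have [[a0 [ca0 na0 gen0]] acQk] := acQ.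
split.
  have [v cv ca1] := chain_push d_gt0 ca0.
  pose a1 := fun x => a0 x + -1 * rbd v x.
  exists a1; split=> //.
    move=> /(is_boundary_simplicial _ _ scK)[b cb bE]; apply: na0.
    apply/(is_boundary_simplicial _ _ scQ).
    exists (fun x => b x + 1 * v x); first exact: chain_lin (chain_sub cb) cv.
    by rewrite rbdD bE; apply/funext => x; rewrite /a1; ring.
  move=> b cb; have [c] := gen0 b (chain_sub cb).
  move=> /(is_boundary_simplicial _ _ scQ)[y cy yE]; exists c.
  apply/(is_boundary_simplicial _ _ scK).
  have bE : rbd (fun x => y x + c * v x) = fun x => b x + - c * a1 x.
    by rewrite rbdD yE; apply/funext => x; rewrite /a1; ring.
  have [||b' cb' b'E] := @chain_fill 0 (fun x => y x + c * v x).
  - exact: chain_lin.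
  - by rewrite bE; exact: chain_lin.
  - exists b' => //; rewrite b'E bE.
    by apply/funext => x; rewrite mulNr.
move=> k a k_gt0 ca; rewrite (boundary_simplicial scK ca) => ra.
have : is_boundary (X := simplicial_cells R Q) k a.
  apply: acQk => //; first exact: chain_sub.
  by rewrite (boundary_simplicial scQ (chain_sub ca)).
move=> /(is_boundary_simplicial _ _ scQ)[b cb bE].
have [||b' cb' b'E] := @chain_fill k b => //; first by rewrite bE.
by apply/(is_boundary_simplicial _ _ scK); exists b'; rewrite // b'E.
Qed.

End Subcomplex.

(* For a minimal detecting J, the boundary identifies the d-chains of Q with the
   functions on J, so deleting the d-simplices and J preserves homology. *)
Lemma collapse : exists K, [/\ simplicial_complex K, acyclic R K,
  forall x, L x -> x \in K & forall x, x \in K -> (#|x| <= d)%N].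
Proof.
have [J [JB dJ hJ]] := minimal_detecting.
exists (collapsed J); split.
- exact: collapsed_complex.
- exact: collapsed_acyclic.
- exact: collapsed_sub.
- by move=> x; rewrite inE => /and3P[].
Qed.

End Collapse.

(** * Simplices of the Bestvina chamber *)

Section BestvinaChamber.

Variables (R : realType) (W : groupType) (S : finType) (gen : S -> W).
Hypothesis hcox : coxeter_system gen.
Variables (n : nat) (P : {set S} -> {set {set 'I_n}}).
Hypothesis hP : bestvina_chamber R gen P.

Implicit Types (F G : {set S}) (x y : {set 'I_n}).

Local Notation sph := (spherical gen).
Local Notation above F := (union_above gen P F).

Lemma bestvina_antimono F G : sph F -> sph G -> F \subset G ->
  {subset P G <= P F}.
Proof.
move=> sF sG FG x xG; have [->//|ne] := eqVneq F G.
apply: (bestvina_sub hP sF); exists G; split=> //.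
by rewrite finset.properEneq ne FG.
Qed.

Lemma bestvina_top F x : sph F -> x \in P F -> exists G,
  [/\ sph G, F \subset G, x \in P G & ~ above G x].
Proof.
move=> sF xF; pose p G := `[< sph G >] && (x \in P G).
have pF : p F by rewrite /p xF andbT; apply/asboolP.
have [G /maxsetP[/andP[/asboolP sG xG] Gmax] FG] := maxset_exists pF.
exists G; split=> // -[G' [sG' /andP[GG' nGG'] xG']].
by move: nGG'; rewrite (Gmax G') ?fintype.subxx // /p xG' andbT; apply/asboolP.
Qed.

(** The simplex [x] is added at a single stage, by disjointness; that stage contains both [F] and
    [G]. *)
Lemma bestvina_join F G x : sph F -> sph G -> x \in P F -> x \in P G ->
  sph (F :|: G)%SET /\ x \in P (F :|: G)%SET.
Proof.
move=> sF sG /(bestvina_top sF)[F1 [sF1 FF1 xF1 nF1]].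
move=> /(bestvina_top sG)[G1 [sG1 GG1 xG1 nG1]].
have E := bestvina_disjoint hP sF1 sG1 xF1 nF1 xG1 nG1; subst G1.
have FG1 : (F :|: G)%SET \subset F1 by rewrite finset.subUset FF1 GG1.
have sFG := sphericalS FG1 sF1; split=> //.
exact: bestvina_antimono FG1 _ xF1.
Qed.

Lemma simplex_type_top F x : sph F -> x \in P F -> ~ above F x ->
  simplex_type P x = F.
Proof.
move=> sF xF nF; apply/finset.setP => s; rewrite inE; apply/idP/idP => [xs|sF'].
  apply: contra_notT nF => sF'.
  have [sFs xFs] := bestvina_join sF (spherical1 hcox s) xF xs.
  exists (F :|: [set s])%SET; split=> //.
  rewrite finset.properEneq finset.subsetUl andbT.
  by apply: contraNneq sF' => ->; rewrite !inE eqxx orbT.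
apply: bestvina_antimono xF => //; first exact: spherical1.
by rewrite finset.sub1set.
Qed.

Lemma simplex_typeP x : x \in P finset.set0 ->
  [/\ sph (simplex_type P x), x \in P (simplex_type P x) &
      forall F, sph F -> x \in P F -> F \subset simplex_type P x].
Proof.
move=> x0; have [G [sG _ xG nG]] := bestvina_top (spherical0 gen) x0.
rewrite (simplex_type_top sG xG nG); split=> // F sF xF.
have [sFG xFG] := bestvina_join sG sF xG xF.
apply: contra_notT nG => FG; exists (G :|: F)%SET; split=> //.
rewrite finset.properEneq finset.subsetUl andbT; apply: contraNneq FG => ->.
exact: finset.subsetUr.
Qed.

Lemma simplex_type_above F x : sph F -> above F x ->
  x \in P finset.set0 /\ F \proper simplex_type P x.
Proof.
move=> sF [G [sG FG xG]].
have x0 : x \in P finset.set0.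
  by apply: bestvina_antimono xG; rewrite ?finset.sub0set //; exact: spherical0.
have [_ _ /(_ _ sG xG) GS] := simplex_typeP x0.
by split=> //; exact: fintype.proper_sub_trans FG GS.
Qed.

Lemma bestvina_relative_cycle d :
  (exists2 x, x \in P finset.set0 & #|x|.-1 = d) ->
  (forall x, x \in P finset.set0 -> (#|x|.-1 <= d)%N) ->
  exists F (z : {set 'I_n} -> R), [/\ sph F,
    forall x, z x != 0 -> [/\ x \in P F, ~ above F x & #|x|.-1 = d],
    exists x, z x != 0 &
    forall y, y \in P finset.set0 -> ~ above F y -> bd z y = 0].
Proof.
move=> [x0 x0P x0d] dimP.
pose p F := `[< sph F /\ exists2 x, x \in P F & #|x|.-1 = d >].
have p0 : p finset.set0.
  by apply/asboolP; split; [exact: spherical0|exists x0].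
have [F /maxsetP[/asboolP[sF [x1 x1F x1d]] Fmax] _] := maxset_exists p0.
have sub0 : {subset P F <= P finset.set0}.
  by apply: bestvina_antimono; rewrite ?finset.sub0set //; exact: spherical0.
have scF := bestvina_complex hP sF.
have dimL x : above F x -> (#|x|.-1 < d)%N.
  move=> Lx; have [xP _] := simplex_type_above sF Lx.
  rewrite ltn_neqAle dimP // andbT; apply/eqP => xd.
  case: Lx => G [sG FG xG].
  have := Fmax G _ (fintype.proper_sub FG).
  have pG : p G by apply/asboolP; split=> //; exists x.
  by move=> /(_ pG) E; rewrite E fintype.properxx in FG.
apply: contrapT => nz.
have rel_inj z : chain (X := simplicial_cells R (P F)) d z ->
    (forall y, y \in P F -> ~ above F y -> bd z y = 0) -> z = fun=> 0.
  move=> cz z0; apply/funext => x; apply/eqP; apply: contraT => zx.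
  exfalso; apply: nz; exists F, z; split=> //.
  - move=> x' /cz[/= x'F x'd]; split=> // /dimL.
    by rewrite x'd ltnn.
  - by exists x.
  - move=> y yP yL; apply/eqP; apply: contraT => ne.
    have [x' [/cz[/= x'F _] yx' _]] := bd_neq0 ne.
    have [y0 _] := bestvina_complex hP (spherical0 gen) yP.
    have [_ /(_ y yx' y0) yF] := scF _ x'F.
    by move: ne; rewrite z0 // eqxx.
(* Collapsing needs d > 0. For d = 0 a single vertex already is a relative cycle, its only proper
   face being empty. *)
have [d0|d_gt0] := posnP d.
  pose z x : R := (x == x1)%:R.
  have /(congr1 (@^~ x1)) : z = fun=> 0.
    apply: rel_inj => [x|y yF _].
      by rewrite /z; have [->|] := eqVneq x x1; rewrite ?eqxx.
    apply/eqP; apply: contraT => /bd_neq0[x []].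
    rewrite /z; have [-> _ _ x1y|_] := eqVneq x x1; last by rewrite eqxx.
    have [+ _] := scF _ yF; move: x1d; rewrite d0 x1y /= => /eqP.
    by rewrite cards_eq0 => ->.
  by rewrite /z eqxx => /eqP; rewrite oner_eq0.
have dimQ x : x \in P F -> (#|x| <= d.+1)%N.
  by move=> /sub0 /dimP; case: #|x|.
have dimL' x : above F x -> (#|x| <= d)%N.
  by move=> /dimL; case: #|x|.
have [K [scK acK LK dimK]] := collapse d_gt0 scF (bestvina_acyclic hP sF) dimQ
  (bestvina_sub hP sF) dimL' rel_inj.
(* The collapsed complex sits on the same vertices, so the identity embeds the union of larger
   pieces, against least dimension. *)
have := bestvina_least hP sF (f := id) scK acK.
have emb : simplicial_embedding (above F) K id.
  by split=> // x /LK; rewrite imset_id.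
move=> /(_ emb); rewrite leqNgt => /negP; apply.
have dF : (d <= simplicial_dim (P F))%N.
  rewrite -x1d /simplicial_dim.
  exact: (@leq_bigmax_cond _ (mem (P F)) (fun x : {set 'I_n} => #|x|.-1)).
apply: leq_trans dF; rewrite -(prednK d_gt0) ltnS.
apply/bigmax_leqP => x /dimK; case: #|x| => //= k.
by rewrite -{1}(prednK d_gt0).
Qed.

End BestvinaChamber.

(** * The cycle *)

Section Cycle.

Variables (R : realType) (W : groupType) (S : finType) (gen : S -> W).
Hypothesis hcox : coxeter_system gen.
Variables (C : building gen) (q : S -> nat).
Hypotheses (hreg : regular_building C q) (hq : forall s, (2 <= q s)%N).
Variables (n : nat) (P : {set S} -> {set {set 'I_n}}).
Hypothesis hP : bestvina_chamber R gen P.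
Variables (F : {set S}) (z : {set 'I_n} -> R) (d : nat) (c0 : C).
Hypothesis sF : spherical gen F.
Hypothesis zP : forall x, z x != 0 ->
  [/\ x \in P F, ~ union_above gen P F x & #|x|.-1 = d].
Hypothesis bdz : forall y, y \in P finset.set0 -> ~ union_above gen P F y ->
  bd z y = 0.

Local Notation X := (bestvina_realization R C P).
Local Notation T := {classic C}.
Local Notation phi := (alt_chamber R q c0).

(* The alternating weight lives on the residue of type S - F of c0, which meets
   every residue of type F in at most one chamber. *)
Definition support : set T := [set c : T | residue (~: F)%SET c0 (c : C)].

Definition fresidue (c : T) : set C := residue F (c : C).

Lemma fresidue_inj : set_inj support fresidue.
Proof.
move=> c c' /set_mem cs /set_mem cs' E.
apply: (residue_disjoint (C := C) hcox R (finset.setICr F)).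
  by rewrite -/(fresidue c) E; exact: residue_refl.
exact: (residue_trans hcox (residue_sym hcox cs) cs').
Qed.

(** The sum has at most one term, by [fresidue_inj]; it transports the weight from chambers to
    residues of type [F], with 0 on residues missing the support. *)
Definition residue_weight (r : set C) : R :=
  \sum_(c \in support `&` [set c | fresidue c = r]) phi c.

Lemma residue_weight_fresidue c : support c ->
  residue_weight (fresidue c) = phi c.
Proof.
move=> cs; rewrite /residue_weight (_ : _ `&` _ = [set c]) ?fsbig_set1 //.
apply/seteqP; split=> [c' [cs' E]|_ ->]; last by [].
by apply: fresidue_inj; rewrite ?inE.
Qed.

Lemma residue_weight_neq0 r : residue_weight r != 0 ->
  exists2 c, support c & fresidue c = r.
Proof.
move=> ne; apply: contrapT => nex; move/eqP: ne; apply.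
by apply: fsbig1 => c [cs E]; case: nex; exists c.
Qed.

Definition residue_cycle (k : ambient X) : R := z k.2 * residue_weight k.1.

Lemma residue_cycle_neq0 k : residue_cycle k != 0 ->
  z k.2 != 0 /\ exists2 c, support c & fresidue c = k.1.
Proof.
rewrite mulf_eq0 negb_or => /andP[zk /residue_weight_neq0 wk].
by split.
Qed.

Lemma chain_residue_cycle : chain (X := X) d residue_cycle.
Proof.
move=> k /residue_cycle_neq0[/zP[xF xL xd] [c cs cE]]; split=> //=; split.
  apply: (bestvina_antimono hP) xF; rewrite ?finset.sub0set //.
  exact: spherical0.
by exists (c : C); rewrite (simplex_type_top hcox hP sF xF xL) -cE.
Qed.

Definition cell_of (k : T * {set 'I_n}) : ambient X := (fresidue k.1, k.2).

Lemma cell_of_inj A : A `<=` support -> set_inj (A `*` setT) cell_of.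
Proof.
move=> As [c x] [c' x'] /set_mem[/= /As cs _] /set_mem[/= /As cs' _].
by case=> /(fresidue_inj (mem_set cs) (mem_set cs'))-> ->.
Qed.

Lemma fsum_finType (f : {set 'I_n} -> R) :
  \sum_(x \in setT) f x = \sum_x f x.
Proof.
rewrite (fsbigE (index_enum _)) ?index_enum_uniq //.
  by rewrite big_mkcond; apply: eq_bigr => x _; rewrite in_setT.
by move=> x _; rewrite mem_index_enum.
Qed.

Lemma boundary_residue_cycle : boundary (X := X) residue_cycle = fun=> 0.
Proof.
apply/funext => -[r y]; rewrite /boundary patchE; case: ifP => // /set_mem.
move=> [/= yP [c1 rE]].
(* Only chambers of the support inside [r] can contribute to the coefficient of (r, y). *)
pose A := support `&` [set c : T | residue (simplex_type P y) c1 (c : C)].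
have [sG yG GS] := simplex_typeP hcox hP yP.
have fA : finite_set A.
  apply: finite_setIr; exact: (finite_residue hcox hreg c1 sG).
have As : A `<=` support by apply: subIsetl.
pose t (k : ambient X) := inc k (r, y) * residue_cycle k.
have tD k : t k != 0 -> cells X k /\ (cell_of @` (A `*` setT)) k.
  rewrite mulf_eq0 negb_or /= => /andP[].
  case: ifPn => [/asboolP sub _ ck|_]; last by rewrite eqxx.
  split; first by have [] := chain_residue_cycle ck.
  have [_ [c cs cE]] := residue_cycle_neq0 ck.
  exists (c, k.2); last by rewrite /cell_of /= cE; case: (k).
  split=> //=; split=> //=; rewrite -rE; apply: sub; rewrite -cE.
  exact: residue_refl.
transitivity (\sum_(k \in setT) t k).
  apply: fsbig_widen => // k [_ kX]; apply/eqP; apply: contraT => /tD[].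
  by move=> /kX.
transitivity (\sum_(k \in cell_of @` (A `*` setT)) t k).
  apply/esym; apply: fsbig_widen => // k [_ kX]; apply/eqP.
  by apply: contraT => /tD[_ /kX].
rewrite fsbig_image; last exact: cell_of_inj.
pose e (c : T) : R := if `[< fresidue c `<=` r >] then 1 else 0.
rewrite (eq_fsbigr (fun k : T * {set 'I_n} =>
    e k.1 * phi k.1 * (simplex_inc R k.2 y * z k.2))); last first.
  move=> [c x] /set_mem[/= /As cs _].
  rewrite /t /residue_cycle /= residue_weight_fresidue // /e.
  by case: ifP => _; rewrite ?mul0r //; ring.
rewrite -(pair_fsbig _ (fun c x => e c * phi c * (simplex_inc R x y * z x))) //;
  last exact: finite_finset.
rewrite (eq_fsbigr (fun c => e c * phi c * bd z y)); last first.
  by move=> c _; rewrite -mulr_fsumr fsum_finType.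
(* The coefficient factors as a weighted sum over [A] times [bd z y]. Off the larger pieces the
   second factor vanishes; on them the first does. *)
rewrite -mulr_fsuml; have [yL|/(bdz yP)->] := pselect (union_above gen P F y);
  last by rewrite mulr0.
(* Now [F] lies in S(y), so [e] is 1 on [A], and [s] in S(y) - F keeps s-panels inside both residues
   that define [A]. *)
have [_ /fintype.properP[FG [s sG' sF']]] := simplex_type_above hcox hP sF yL.
rewrite (eq_fsbigr phi); last first.
  move=> c /set_mem[_ /= cG]; rewrite /e ifT ?mul1r //; apply/asboolP.
  by rewrite rE (residue_eq hcox cG); exact: residueS.
rewrite (@sum_panel_closed _ _ _ _ hcox _ _ hreg hq c0 s) ?mul0r //.
move=> c c' [cs cG] cc'; split.
  by apply: (residue_sequiv hcox _ cs cc'); rewrite inE.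
exact: (residue_sequiv hcox sG' cG cc').
Qed.

Variable p : R.
Hypothesis hp : (1 + growth R gen q < p%:E)%E.

Lemma lp_residue_cycle :
  (\esum_(k in cells X) (`|residue_cycle k| `^ p)%:E < +oo)%E.
Proof.
have p1 := growth_exponent_gt1 hcox hreg hq hp.
(* Needed for 0 to the power [p] to be 0, so that cells off the support contribute nothing. *)
have p0 : p != 0 by rewrite gt_eqF // (lt_trans ltr01).
pose g (k : ambient X) := (`|residue_cycle k| `^ p)%:E.
have g0 k : (0 <= g k)%E by rewrite lee_fin powR_ge0.
have [N setN] : exists N, ([set: {set 'I_n}] #= `I_N)%card.
  by apply/finite_setP; exact: finite_finset.
have [M zM] : exists M, forall x, `|z x| `^ p <= M%:R.
  exists (Num.truncn (\sum_x `|z x| `^ p)).+1 => x.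
  apply: (@le_trans _ _ (\sum_x `|z x| `^ p)); last exact/ltW/truncnS_gt.
  by rewrite (bigD1 x) //= lerDl sumr_ge0 // => y _; exact: powR_ge0.
apply: (@le_lt_trans _ _
    (\esum_(k in cell_of @` (support `*` setT)) g k)%E).
  rewrite esum_mkcond [leRHS]esum_mkcond; apply: le_esum => k _.
  case: ifP => _; last by case: ifP.
  case: ifPn => // kD; rewrite /g.
  suff -> : residue_cycle k = 0 by rewrite normr0 powR0.
  apply/eqP; apply: contraNT kD => /residue_cycle_neq0[_ [c cs cE]].
  by rewrite inE; exists (c, k.2) => //; rewrite /cell_of /= cE; case: (k).
rewrite esum_image; last exact: cell_of_inj.
rewrite -(esum_esum (J := fun=> setT) (a := fun c x => g (cell_of (c, x)))) //.
(* Each chamber carries at most [N] cells, each with factor at most [M]; writing M N as a finite sum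
   reduces to M N copies of the chamber series. *)
apply: (@le_lt_trans _ _ (\esum_(c in [set: T])
    \sum_(j < M * N) (`|phi c| `^ p)%:E)%E).
  rewrite esum_mkcond; apply: le_esum => c _.
  case: ifPn => [/set_mem cs|_]; last first.
    by apply: sume_ge0 => j _; rewrite lee_fin powR_ge0.
  rewrite sumEFin sumr_const card_ord mulrnA.
  rewrite -(esum_cst _ setN); last by rewrite mulrn_wge0 // powR_ge0.
  apply: le_esum => x _; rewrite lee_fin /residue_cycle /=.
  rewrite residue_weight_fresidue //.
  rewrite normrM powRM // -mulr_natl ler_wpM2r // ?powR_ge0 //.
rewrite esum_sum; last by move=> *; rewrite lee_fin powR_ge0.
apply: lte_sum_pinfty => j _.
exact: summable_alt_chamber.
Qed.

Lemma residue_cycle_nonzero x :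
  z x != 0 -> residue_cycle (fresidue (c0 : T), x) != 0.
Proof.
move=> zx; rewrite /residue_cycle /=.
rewrite residue_weight_fresidue; last exact: residue_refl.
rewrite /alt_chamber (proj2 (dW_eq1 _ _) erefl) (alt_weight1 _ hcox hreg).
by rewrite mulr1.
Qed.

End Cycle.

Unset Implicit Arguments.

Theorem theorem1p4 (R : realType)
    (W : groupType) (S : finType) (gen : S -> W)
    (hcox : coxeter_system gen) (hW : infinite_set [set: W])
    (C : building gen) (q : S -> nat)
    (hreg : regular_building C q) (hq : forall s, (2 <= q s)%N)
    (n : nat) (P : {set S} -> {set {set 'I_n}})
    (hP : bestvina_chamber R gen P)
    (d : nat) (hdim : has_dim (bestvina_realization R C P) d)
    (hvcd : virtual_cohomological_dim R W d)
    (p : R) (hp : (1 + growth R gen q < p%:E)%E) :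
  lp_homology_nonzero (bestvina_realization R C P) p d.
Proof.
have [c0] := building_inhabited C.
have [[[r0 x0] [/= x0P _] x0d] dimX] := hdim.
have [||F [z [sF zP [x zx] bdz]]] := bestvina_relative_cycle hcox hP (d := d).
- by exists x0.
(* Every simplex of the chamber has a copy at [c0], so the dimension bound passes from the
   realization to the chamber. *)
- move=> x xP; apply: (dimX (residue (simplex_type P x) c0, x)).
  by split=> //; exists c0.
pose a := residue_cycle q (P := P) F z c0.
have ca : chain d a := chain_residue_cycle hcox hP sF zP.
exists a; split.
- split; [exact: ca|exact: (lp_residue_cycle hcox hreg hq P F z c0 hp)].
- exact: (boundary_residue_cycle hcox hreg hq hP c0 sF zP bdz).
move=> [b [cb _] bE].
have b0 : b = fun=> 0.
  apply/funext => k; apply/eqP; apply: contraT => /cb[/dimX kX kd].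
  have : (d.+1 <= d)%N by rewrite -{1}kd; exact: kX.
  by rewrite ltnn.
have a0 : a = fun=> 0.
  rewrite -bE b0; apply/funext => k; rewrite /boundary patchE.
  by case: ifP => // _; apply: fsbig1 => k' _; rewrite mulr0.
have := residue_cycle_nonzero hcox hreg P F c0 zx.
by rewrite -/a a0 eqxx.
Qed.
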